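(* Let $(R,\mathfrak m)$ be a Cohen-Macaulay local ring of dimension $d$, and let $I$ be an $\mathfrak m$-primary ideal of $R$ containing a parameter ideal $Q=(x_1,\ldots,x_d)$ as a reduction. Let $M,N$ be maximal Cohen-Macaulay $R$-modules such that $\mathrm{Hom}_R(M,N)\neq 0$ and $\mathrm{Ext}_R^i(M,N)=0$ for all $i=1,\ldots,n$, where either $n=d-1$ or $n=d$. Assume that $M$ (resp. $N$) is an Ulrich $R$-module with respect to $I$, and consider the following conditions: (i) $\mathrm{Hom}_R(M,N)$ is an Ulrich $R$-module with respect to $I$; (ii) $\mathrm{Hom}_R(M,N)/I\,\mathrm{Hom}_R(M,N)$ is a free $R/I$-module; (iii) $\mathrm{Hom}_{R/Q}(R/I,N/QN)$ (resp. $\mathrm{Hom}_{R/Q}(M/QM,R/I)$) is a free $R/I$-module. Then: (a) if $n=d-1$, then (i) $\Leftrightarrow$ (ii); (b) if $n=d$, then (i) $\Leftrightarrow$ (ii) $\Leftrightarrow$ (iii). (Here ''resp.'' means that the theorem consists of two versions: one in which $M$ is assumed Ulrich with respect to $I$ and (iii) is the first condition, and one in which $N$ is assumed Ulrich with respect to $I$ and (iii) is the second condition.)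
   Context: All rings are commutative and Noetherian with 1; ''finite'' module means finitely generated. A finite module $M$ over a local ring $R$ is maximal Cohen-Macaulay if $\mathrm{depth}_R M=\dim R$; the zero module (depth $+\infty$) is not maximal Cohen-Macaulay. A parameter ideal is an ideal generated by a system of parameters of $R$. That $Q\subset I$ is a reduction of $I$ means $QI^r=I^{r+1}$ for some integer $r\ge 0$. A finite $R$-module $M$ is Ulrich with respect to $I$ if: $M$ is a maximal Cohen-Macaulay $R$-module; $IM=QM$; and $M/IM$ is a free $R/I$-module. *)

(* Defs.v *)
From HB Require Import structures.
From mathcomp Require Import all_boot all_algebra ring_quotient boolp.
From mathcomp Require Import freeg.

Set Implicit Arguments.
Unset Strict Implicit.
Unset Printing Implicit Defensive.

Import GRing.Theory.
Local Open Scope ring_scope.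
Local Open Scope quotient_scope.

(** Ideals are boolean predicates ([idealr R] is MathComp's structure of proper
    ideals); since [boolp] makes every [Prop] decidable through [`[< _ >]], this
    is no restriction. *)

Section SubmoduleType.
Variables (R : pzRingType) (V : lmodType R) (S : submodClosed V).

Definition submod : Type := {v : V | v \in (S : {pred V})}.

HB.instance Definition _ := SubChoice.on submod.
HB.instance Definition _ := [SubChoice_isSubLmodule of submod by <:].

End SubmoduleType.

(* The quotient construction asks for closure under opposite, which
   [submodClosed] does not record; [oppclosed S] is [S] with that added. *)
Definition oppclosed (R : pzRingType) (V : lmodType R) (S : submodClosed V) :
  {pred V} := S.

Lemma oppclosed_zmod (R : pzRingType) (V : lmodType R) (S : submodClosed V) :
  zmod_closed (oppclosed S).
Proof. exact/submodClosedP. Qed.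

HB.instance Definition _ (R : pzRingType) (V : lmodType R) (S : submodClosed V) :=
  GRing.isZmodClosed.Build V (oppclosed S) (oppclosed_zmod S).

Section QuotientModule.
Variables (R : pzRingType) (V : lmodType R) (S : submodClosed V).

Definition quotmod : Type := Quotient.quot (oppclosed S).

HB.instance Definition _ := GRing.Zmodule.on quotmod.

Definition quotmod_pi (v : V) : quotmod := \pi_(Quotient.quot (oppclosed S)) v.

Lemma quotmod_piE u v : (quotmod_pi u = quotmod_pi v) <-> (u - v \in S).
Proof.
split=> [/eqP|uv]; first by rewrite (Quotient.idealrBE (oppclosed S)).
by apply/eqP; rewrite /quotmod_pi -(Quotient.idealrBE (oppclosed S)).
Qed.

Lemma quotmod_piK (x : quotmod) : quotmod_pi (repr (x : Quotient.quot (oppclosed S))) = x.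
Proof. exact: reprK. Qed.

Lemma quotmod_piD u v : quotmod_pi (u + v) = quotmod_pi u + quotmod_pi v.
Proof. exact: (raddfD (\pi_(Quotient.quot (oppclosed S)))). Qed.

Definition quotmod_scale (a : R) (x : quotmod) : quotmod :=
  quotmod_pi (a *: repr (x : Quotient.quot (oppclosed S))).

Lemma quotmod_scale_pi a v : quotmod_scale a (quotmod_pi v) = quotmod_pi (a *: v).
Proof.
apply/quotmod_piE; rewrite -scalerBr rpredZ //.
by apply/quotmod_piE; rewrite quotmod_piK.
Qed.

Let scaleA a b x : quotmod_scale a (quotmod_scale b x) = quotmod_scale (a * b) x.
Proof. by rewrite -[x]quotmod_piK !quotmod_scale_pi scalerA. Qed.
Let scale1 : left_id 1 quotmod_scale.
Proof. by move=> x; rewrite -[x]quotmod_piK !quotmod_scale_pi scale1r. Qed.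
Let scaleDr : right_distributive quotmod_scale +%R.
Proof.
move=> a x y; rewrite -[x]quotmod_piK -[y]quotmod_piK -quotmod_piD.
by rewrite !quotmod_scale_pi scalerDr quotmod_piD.
Qed.
Let scaleDl x : {morph quotmod_scale^~ x : a b / a + b}.
Proof.
move=> a b; rewrite -[x]quotmod_piK !quotmod_scale_pi scalerDl.
by rewrite quotmod_piD.
Qed.

HB.instance Definition _ :=
  GRing.Zmodule_isLmodule.Build R quotmod scaleA scale1 scaleDr scaleDl.

End QuotientModule.

Section IdealProduct.
Variables (R : comNzRingType) (V : lmodType R).

Definition setmul (I : {pred R}) (S : {pred V}) : {pred V} := fun v =>
  `[< exists s : seq (R * V),
        all (fun p => (p.1 \in I) && (p.2 \in S)) s
        /\ v = \sum_(p <- s) p.1 *: p.2 >].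

Definition idealmod (I : idealr R) : {pred V} := setmul I predT.

Lemma idealmod_submod I : submod_closed (idealmod I).
Proof.
split=> [|a u v /asboolP[s [sI ->]] /asboolP[t [tI ->]]]; apply/asboolP.
  by exists [::]; rewrite big_nil.
exists ([seq (a * p.1, p.2) | p <- s] ++ t); split.
  rewrite all_cat tI andbT all_map; apply: sub_all sI => p /=.
  by rewrite !inE !andbT => pI; apply: idealMr.
by rewrite big_cat big_map scaler_sumr; congr (_ + _);
   apply: eq_bigr => p _; rewrite scalerA.
Qed.

HB.instance Definition _ I :=
  GRing.isSubmodClosed.Build R V (idealmod I) (idealmod_submod I).

End IdealProduct.

Arguments idealmod {R} V I.

Fixpoint idealpow (R : comNzRingType) (I : idealr R) (n : nat) : {pred R} :=
  if n is n'.+1 then setmul (V := R^o) I (idealpow I n') else predT.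

(* [red I V] is V/IV as an R/I-module; it has the same carrier as the R-module
   [quotmod (idealmod V I)]. *)
Section Reduction.
Variables (R : comNzRingType) (I : idealr R) (V : lmodType R).

Definition red : Type := quotmod (idealmod V I).

HB.instance Definition _ := GRing.Zmodule.on red.

Definition red_scale (a : {ideal_quot I}) (x : red) : red :=
  repr a *: (x : quotmod (idealmod V I)).

Lemma red_scale_pi a v :
  red_scale (\pi_({ideal_quot I}) a) (quotmod_pi (idealmod V I) v)
  = quotmod_pi (idealmod V I) (a *: v).
Proof.
rewrite /red_scale [LHS]quotmod_scale_pi; apply/quotmod_piE.
rewrite -scalerBl; apply/asboolP.
exists [:: (repr (\pi_({ideal_quot I}) a) - a, v)].
rewrite big_seq1 /= !inE !andbT; split=> //.
by rewrite Quotient.idealrBE reprK.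
Qed.

Let pi_surj (a : {ideal_quot I}) : exists r, a = \pi_({ideal_quot I}) r.
Proof. by exists (repr a); rewrite reprK. Qed.
Let red_surj (x : red) : exists v, x = quotmod_pi (idealmod V I) v.
Proof. by exists (repr (x : Quotient.quot _)); rewrite quotmod_piK. Qed.

Let scaleA a b x : red_scale a (red_scale b x) = red_scale (a * b) x.
Proof.
have [[[r ->] [s ->]] [v ->]] := (pi_surj a, pi_surj b, red_surj x).
by rewrite -rmorphM !red_scale_pi scalerA.
Qed.
Let scale1 : left_id 1 red_scale.
Proof.
move=> x; have [v ->] := red_surj x.
by rewrite -(rmorph1 (\pi_({ideal_quot I}))) red_scale_pi scale1r.
Qed.
Let scaleDr : right_distributive red_scale +%R.
Proof. by move=> a x y; exact: scalerDr. Qed.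
Let scaleDl x : {morph red_scale^~ x : a b / a + b}.
Proof.
move=> a b; have [[[r ->] [s ->]] [v ->]] := (pi_surj a, pi_surj b, red_surj x).
by rewrite -rmorphD !red_scale_pi scalerDl quotmod_piD.
Qed.

HB.instance Definition _ :=
  GRing.Zmodule_isLmodule.Build {ideal_quot I} red scaleA scale1 scaleDr scaleDl.

End Reduction.

Section Hom.
Variables (R : comPzRingType) (U V : lmodType R).

Definition lhom : Type := {linear U -> V}.

HB.instance Definition _ := gen_eqMixin lhom.
HB.instance Definition _ := gen_choiceMixin lhom.

Lemma lhomP (f g : lhom) : f =1 g -> f = g.
Proof.
case: f g => [f cf] [g cg] /= /funext fg; case: g / fg in cg *.
case: cf cg => [[af] [sf]] [[ag] [sg]].
by rewrite (Prop_irrelevance af ag) (Prop_irrelevance sf sg).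
Qed.

Definition lhom0 : lhom := (\0 : {linear U -> V}).
Definition lhomN (f : lhom) : lhom := (\- f : {linear U -> V}).
Definition lhomD (f g : lhom) : lhom := (f \+ g : {linear U -> V}).
Definition lhomZ (a : R) (f : lhom) : lhom := (a \*: f : {linear U -> V}).

Let addA : associative lhomD.
Proof. by move=> f g h; apply: lhomP => u /=; rewrite addrA. Qed.
Let addC : commutative lhomD.
Proof. by move=> f g; apply: lhomP => u /=; rewrite addrC. Qed.
Let add0 : left_id lhom0 lhomD.
Proof. by move=> f; apply: lhomP => u /=; rewrite add0r. Qed.
Let addN : left_inverse lhom0 lhomN lhomD.
Proof. by move=> f; apply: lhomP => u /=; rewrite addNr. Qed.

HB.instance Definition _ := GRing.isZmodule.Build lhom addA addC add0 addN.

Let scaleA a b f : lhomZ a (lhomZ b f) = lhomZ (a * b) f.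
Proof. by apply: lhomP => u /=; rewrite scalerA. Qed.
Let scale1 : left_id 1 lhomZ.
Proof. by move=> f; apply: lhomP => u /=; rewrite scale1r. Qed.
Let scaleDr : right_distributive lhomZ +%R.
Proof. by move=> a f g; apply: lhomP => u /=; rewrite scalerDr. Qed.
Let scaleDl f : {morph lhomZ^~ f : a b / a + b}.
Proof. by move=> a b; apply: lhomP => u /=; rewrite scalerDl. Qed.

HB.instance Definition _ :=
  GRing.Zmodule_isLmodule.Build R lhom scaleA scale1 scaleDr scaleDl.

End Hom.

Definition restrict (A B : comPzRingType) (f : {rmorphism A -> B})
  (W : lmodType B) : Type := W.

Section ChangeOfRings.
Variables (A B : comPzRingType) (f : {rmorphism A -> B}).

Section Restrict.
Variable W : lmodType B.

HB.instance Definition _ := GRing.Zmodule.on (restrict f W).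

Definition restrict_scale (a : A) (w : restrict f W) : restrict f W :=
  f a *: (w : W).

Let scaleA a b w : restrict_scale a (restrict_scale b w) = restrict_scale (a * b) w.
Proof. by rewrite /restrict_scale rmorphM scalerA. Qed.
Let scale1 : left_id 1 restrict_scale.
Proof. by move=> w; rewrite /restrict_scale rmorph1 scale1r. Qed.
Let scaleDr : right_distributive restrict_scale +%R.
Proof. by move=> a v w; exact: scalerDr. Qed.
Let scaleDl w : {morph restrict_scale^~ w : a b / a + b}.
Proof. by move=> a b; rewrite /restrict_scale rmorphD; exact: scalerDl. Qed.

HB.instance Definition _ :=
  GRing.Zmodule_isLmodule.Build A (restrict f W) scaleA scale1 scaleDr scaleDl.

End Restrict.

(* For a B-module W, [hom_from W Y] is Hom_A(W, Y) and [hom_to X W] is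
   Hom_A(X, W), both as B-modules through W. *)
Section HomFrom.
Variables (W : lmodType B) (Y : lmodType A).

Definition hom_from : Type := lhom (restrict f W) Y.

HB.instance Definition _ := GRing.Zmodule.on (hom_from).

Section Scale.
Variables (b : B) (g : hom_from).

Definition hom_from_fun (w : restrict f W) : Y :=
  (g : lhom _ _) (b *: (w : W) : restrict f W).

Lemma hom_from_is_linear : linear hom_from_fun.
Proof.
move=> a v w; rewrite /hom_from_fun.
have -> : b *: ((a *: v + w : restrict f W) : W)
        = a *: (b *: (v : W) : restrict f W) + (b *: (w : W) : restrict f W).
  by rewrite [LHS]scalerDr; congr (_ + _); rewrite [LHS]scalerA mulrC -scalerA.
by rewrite linearP.
Qed.

HB.instance Definition _ :=
  GRing.isLinear.Build A (restrict f W) Y *:%R hom_from_fun hom_from_is_linear.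

Definition hom_from_scale : hom_from := (hom_from_fun : {linear _ -> _}).

End Scale.

Let scaleA a b g : hom_from_scale a (hom_from_scale b g) = hom_from_scale (a * b) g.
Proof.
by apply: lhomP => w; rewrite /= /hom_from_fun /= /hom_from_fun scalerA mulrC.
Qed.
Let scale1 : left_id 1 hom_from_scale.
Proof. by move=> g; apply: lhomP => w; rewrite /= /hom_from_fun scale1r. Qed.
Let scaleDr : right_distributive hom_from_scale +%R.
Proof. by move=> a g h; apply: lhomP. Qed.
Let scaleDl g : {morph hom_from_scale^~ g : a b / a + b}.
Proof.
by move=> a b; apply: lhomP => w; rewrite /= /hom_from_fun scalerDl linearD.
Qed.

HB.instance Definition _ :=
  GRing.Zmodule_isLmodule.Build B (hom_from) scaleA scale1 scaleDr scaleDl.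

End HomFrom.

Section HomTo.
Variables (X : lmodType A) (W : lmodType B).

Definition hom_to : Type := lhom X (restrict f W).

HB.instance Definition _ := GRing.Zmodule.on (hom_to).

Section Scale.
Variables (b : B) (g : hom_to).

Definition hom_to_fun (x : X) : restrict f W := b *: ((g : lhom _ _) x : W).

Lemma hom_to_is_linear : linear hom_to_fun.
Proof.
move=> a x y; rewrite /hom_to_fun linearP [LHS]scalerDr; congr (_ + _).
by rewrite [LHS]scalerA mulrC -scalerA.
Qed.

HB.instance Definition _ :=
  GRing.isLinear.Build A X (restrict f W) *:%R hom_to_fun hom_to_is_linear.

Definition hom_to_scale : hom_to := (hom_to_fun : {linear _ -> _}).

End Scale.

Let scaleA a b g : hom_to_scale a (hom_to_scale b g) = hom_to_scale (a * b) g.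
Proof. by apply: lhomP => x; exact: (@scalerA B W). Qed.
Let scale1 : left_id 1 hom_to_scale.
Proof. by move=> g; apply: lhomP => x; exact: (@scale1r B W). Qed.
Let scaleDr : right_distributive hom_to_scale +%R.
Proof. by move=> a g h; apply: lhomP => x; exact: (@scalerDr B W). Qed.
Let scaleDl g : {morph hom_to_scale^~ g : a b / a + b}.
Proof. by move=> a b; apply: lhomP => x; exact: (@scalerDl B W). Qed.

HB.instance Definition _ :=
  GRing.Zmodule_isLmodule.Build B (hom_to) scaleA scale1 scaleDr scaleDl.

End HomTo.

End ChangeOfRings.

Definition quot_map (R : comNzRingType) (Q I : idealr R)
    (QI : {subset Q <= I}) : {ideal_quot Q} -> {ideal_quot I} :=
  fun x => \pi_({ideal_quot I}) (repr x).

Section QuotientMap.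
Variables (R : comNzRingType) (Q I : idealr R) (QI : {subset Q <= I}).

Lemma quot_map_pi r :
  quot_map QI (\pi_({ideal_quot Q}) r) = \pi_({ideal_quot I}) r.
Proof.
apply/eqP; rewrite /quot_map -Quotient.idealrBE; apply: QI.
by rewrite Quotient.idealrBE reprK.
Qed.

Let surj (a : {ideal_quot Q}) : exists r, a = \pi_({ideal_quot Q}) r.
Proof. by exists (repr a); rewrite reprK. Qed.

Lemma quot_map_zmod : zmod_morphism (quot_map QI).
Proof.
move=> a b; have [[r ->] [s ->]] := (surj a, surj b).
by rewrite -rmorphB !quot_map_pi rmorphB.
Qed.

Lemma quot_map_monoid : monoid_morphism (quot_map QI).
Proof.
split=> [|a b].
  by rewrite -(rmorph1 (\pi_({ideal_quot Q}))) quot_map_pi rmorph1.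
have [[r ->] [s ->]] := (surj a, surj b).
by rewrite -rmorphM !quot_map_pi rmorphM.
Qed.

HB.instance Definition _ := GRing.isZmodMorphism.Build
  {ideal_quot Q} {ideal_quot I} (quot_map QI) quot_map_zmod.
HB.instance Definition _ := GRing.isMonoidMorphism.Build
  {ideal_quot Q} {ideal_quot I} (quot_map QI) quot_map_monoid.

End QuotientMap.

(* Ext^i(M, N) is the i-th cohomology of Hom(F, N), where F is the following
   free resolution of M: F_0 is free on the underlying set of M, mapping onto
   M in the evident way, and one iterates on the kernel. *)

Section Augmentation.
Variables (R : comNzRingType) (V : lmodType R).

Definition cover : Type := {freeg V / R}.

HB.instance Definition _ := GRing.Lmodule.on cover.

Definition aug : cover -> V := fglift id.

Lemma aug_is_zmod : zmod_morphism aug.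
Proof. exact: lift_is_additive. Qed.

HB.instance Definition _ := GRing.isZmodMorphism.Build cover V aug aug_is_zmod.

Lemma aug_is_scalable : scalable aug.
Proof.
move=> a D; have augE : aug D = \sum_(x <- dom D) coeff x D *: x.
  rewrite -[in LHS](freeg_sumE D) (raddf_sum aug).
  by apply: eq_bigr => x _; exact: liftU.
rewrite augE scaler_sumr (raddf_sum aug).
by apply: eq_bigr => x _; rewrite scalerA; exact: liftU.
Qed.

HB.instance Definition _ := GRing.isScalable.Build R cover V *:%R aug aug_is_scalable.

Lemma aug_surj v : exists D, aug D = v.
Proof. by exists [freeg [:: (1, v)]]; rewrite -[RHS]scale1r; exact: liftU. Qed.

End Augmentation.

Section Kernel.
Variables (R : pzRingType) (U V : lmodType R).

Definition ker (f : {linear U -> V}) : {pred U} := fun u => f u == 0.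

Lemma ker_submod f : submod_closed (ker f).
Proof.
split=> [|a u v]; first by rewrite unfold_in linear0.
by rewrite !unfold_in => /eqP fu /eqP fv; rewrite linearP fu fv scaler0 addr0.
Qed.

HB.instance Definition _ f := GRing.isSubmodClosed.Build R U (ker f) (ker_submod f).

Definition im (f : {linear U -> V}) : {pred V} := fun v => `[< exists u, f u = v >].

Lemma im_submod f : submod_closed (im f).
Proof.
split=> [|a u v /asboolP[u' <-] /asboolP[v' <-]]; apply/asboolP.
  by exists 0; rewrite linear0.
by exists (a *: u' + v'); rewrite linearP.
Qed.

HB.instance Definition _ f := GRing.isSubmodClosed.Build R V (im f) (im_submod f).

End Kernel.

Section Ext.
Variable R : comNzRingType.
Implicit Types M N : lmodType R.

Fixpoint syzygy M (i : nat) : lmodType R :=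
  if i is i'.+1 then submod (ker (@aug R (syzygy M i'))) else M.

Definition res M i : lmodType R := cover (syzygy M i).

Definition res_d M i : {linear res M i.+1 -> res M i} :=
  (val : submod (ker (@aug R (syzygy M i))) -> res M i)
  \o (@aug R (syzygy M i.+1)).

Section Precomp.
Variables (U V N : lmodType R) (d : {linear U -> V}).

Definition precomp (g : lhom V N) : lhom U N := ((g \o d) : {linear U -> N}).

Lemma precomp_is_linear : linear precomp.
Proof. by move=> a g h; apply: lhomP. Qed.

HB.instance Definition _ :=
  GRing.isLinear.Build R (lhom V N) (lhom U N) *:%R precomp precomp_is_linear.

End Precomp.

Definition coch M N i : lmodType R := lhom (res M i) N.

Definition coch_d M N i : {linear coch M N i -> coch M N i.+1} :=
  @precomp (res M i.+1) (res M i) N (res_d M i).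

Definition cocycles M N i : lmodType R := submod (ker (coch_d M N i)).

Definition boundary M N i : {pred coch M N i} :=
  match i with
  | 0 => pred1 0
  | i'.+1 => im (coch_d M N i')
  end.

Definition coboundaries M N i : {pred cocycles M N i} :=
  fun z => \val z \in @boundary M N i.

Lemma coboundaries_submod M N i : submod_closed (@coboundaries M N i).
Proof.
have [b0 bP] : submod_closed (@boundary M N i).
  case: i => [|i] /=; last exact: im_submod.
  split=> [|a u v]; first by rewrite !inE.
  by rewrite !inE => /eqP-> /eqP->; rewrite scaler0 addr0.
split=> [|a u v]; rewrite !unfold_in ?raddf0 // => bu bv.
by rewrite linearP; apply: bP.
Qed.

HB.instance Definition _ M N i := GRing.isSubmodClosed.Build R (cocycles M N i)
  (@coboundaries M N i) (@coboundaries_submod M N i).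

Definition Ext M N i : lmodType R := quotmod (@coboundaries M N i).

End Ext.

Section FiniteFree.
Variables (R : pzRingType) (V : lmodType R).

Definition in_span (s : seq V) (v : V) : Prop :=
  exists c : nat -> R, v = \sum_(i < size s) c i *: s`_i.

Definition finite_module : Prop := exists s : seq V, forall v, in_span s v.

Definition is_basis (B : V -> Prop) : Prop :=
  (forall v, exists2 s : seq V, (forall b, b \in s -> B b) & in_span s v) /\
  (forall (s : seq V) (c : V -> R), uniq s -> (forall b, b \in s -> B b) ->
     \sum_(b <- s) c b *: b = 0 -> forall b, b \in s -> c b = 0).

Definition free_module : Prop := exists B, is_basis B.

End FiniteFree.

Section LocalAlgebra.
Variable R : comNzRingType.
Implicit Types (m I J Q : idealr R) (V : lmodType R).

Definition noetherian : Prop :=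
  forall J : submodClosed R^o, exists s : seq R^o, forall a, a \in J <-> in_span s a.

Definition maximal_ideal m : Prop :=
  forall J, {subset m <= J} -> {subset J <= m}.

Definition local_ring m : Prop :=
  maximal_ideal m /\ forall J, maximal_ideal J -> J =i m.

Definition prime_chain (n : nat) (p : 'I_n.+1 -> prime_idealr R) : Prop :=
  forall i j : 'I_n.+1, (i < j)%N ->
    {subset p i <= p j} /\ exists a, (a \in p j) && (a \notin p i).

Definition krull_dim (d : nat) : Prop :=
  (exists p : 'I_d.+1 -> prime_idealr R, prime_chain p) /\
  (forall n (p : 'I_n.+1 -> prime_idealr R), prime_chain p -> (n <= d)%N).

Definition in_seqmod (s : seq R) V (v : V) : Prop :=
  exists w : nat -> V, v = \sum_(j < size s) s`_j *: w j.

Definition regular_seq V (s : seq R) : Prop :=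
  (forall i (v : V), (i < size s)%N ->
     in_seqmod (take i s) (s`_i *: v) -> in_seqmod (take i s) v) /\
  (exists v : V, ~ in_seqmod s v).

(* Supremum of the lengths of the V-regular sequences in m. Not even the empty
   sequence is regular on the zero module, so [has_depth m V n] excludes V = 0,
   whose depth is +oo. *)
Definition has_depth m V (n : nat) : Prop :=
  (exists s, [/\ all [in m] s, regular_seq V s & size s = n]) /\
  (forall s, all [in m] s -> regular_seq V s -> (size s <= n)%N).

Definition maximal_CM m V : Prop :=
  finite_module V /\ exists2 d, krull_dim d & has_depth m V d.

Definition cohen_macaulay_ring m : Prop := maximal_CM m R^o.

Definition primary_to m I : Prop :=
  (forall a b, a * b \in I -> a \notin I -> exists n, b ^+ n \in I) /\
  (forall a, a \in m <-> exists n, a ^+ n \in I).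

(* [x] is a system of parameters and generates [Q]. *)
Definition parameter_ideal m (x : seq R) Q : Prop :=
  [/\ krull_dim (size x), forall a, a \in Q <-> in_span (x : seq R^o) a
    & primary_to m Q].

Definition reduction Q I : Prop :=
  {subset Q <= I} /\
  exists r, setmul (V := R^o) Q (idealpow I r) =i idealpow I r.+1.

(* [Q] is a fixed parameter ideal that is a reduction of [I]. *)
Definition ulrich m I Q V : Prop :=
  [/\ maximal_CM m V, idealmod V I =i idealmod V Q
    & free_module (red I V : lmodType {ideal_quot I})].

End LocalAlgebra.

(* Main.v *)
From HB Require Import structures.
Require Import Defs.
From mathcomp Require Import all_boot all_algebra ring_quotient.
From mathcomp Require Import boolp freeg.
From mathcomp Require classical_sets.

(** Write [H = Hom(M, N)].  Koszul cohomology shows that a system of parameters is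
    regular on every maximal Cohen-Macaulay module, and that no regular sequence on
    a nonzero finite module is longer than a system of parameters: vanishing in low
    degrees passes from [V/yV] to [V] whenever [y] is [V]-regular and has a power in
    [Q], and conversely, by Nakayama, it forces regularity.

    If [a] is [N]-regular and [Ext^1(M, N) = 0], then every map [M -> N/aN] lifts to
    [N], and the vanishing of [Ext^i(M, -)] in degrees up to [j+1] for [N] gives it up
    to [j] for [N/aN].  Hence, if [Ext^i(M, N) = 0] for [0 < i < d], the parameters
    are [H]-regular and [QH] consists of the maps with image in [QN].  If [I] kills
    [M/QM] or [N/QN], it follows that [IH = QH], which gives (i) <-> (ii).  If in
    addition [Ext^d(M, N) = 0], then [H/IH = Hom(M, N/QN)]; writing the Ulrich module
    modulo [Q] as [(R/I)^r] with [r > 0], this is the [r]-th power of the module of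
    (iii), and over a local ring a finite direct summand of a free module is free. *)

Set Implicit Arguments.
Unset Strict Implicit.
Unset Printing Implicit Defensive.

Import GRing.Theory.
Local Open Scope ring_scope.
Local Open Scope quotient_scope.

(** * Submodules and spans *)

Section Submodules.
Variables (R : comNzRingType) (V : lmodType R).
Implicit Types (S : V -> Prop) (s t : seq V) (u v : V).

Definition submodp S : Prop :=
  S 0 /\ forall a u v, S u -> S v -> S (a *: u + v).

Lemma submodpD S u v : submodp S -> S u -> S v -> S (u + v).
Proof. by move=> [_ SP] Su Sv; rewrite -[u]scale1r; apply: SP. Qed.

Lemma submodpZ S a u : submodp S -> S u -> S (a *: u).
Proof. by move=> [S0 SP] Su; rewrite -[_ *: _]addr0; apply: SP. Qed.

Lemma submodpN S u : submodp S -> S u -> S (- u).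
Proof. by move=> hS Su; rewrite -scaleN1r; apply: submodpZ. Qed.

Lemma submodpB S u v : submodp S -> S u -> S v -> S (u - v).
Proof. by move=> hS Su Sv; apply: submodpD => //; apply: submodpN. Qed.

Lemma submodp_sum S (J : Type) (r : seq J) (F : J -> V) :
  submodp S -> (forall j, S (F j)) -> S (\sum_(j <- r) F j).
Proof.
move=> hS SF; elim: r => [|j r IH]; first by rewrite big_nil; case: hS.
by rewrite big_cons; apply: submodpD.
Qed.

Definition submod_pred S (hS : submodp S) : {pred V} := fun v => `[< S v >].

Lemma submod_pred_closed S (hS : submodp S) : submod_closed (submod_pred hS).
Proof.
case: (hS) => S0 SP; split=> [|a u v /asboolP Su /asboolP Sv]; apply/asboolP => //.
exact: SP.
Qed.

HB.instance Definition _ S (hS : submodp S) :=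
  GRing.isSubmodClosed.Build R V (submod_pred hS) (submod_pred_closed hS).

Lemma submod_predE S (hS : submodp S) v : (v \in submod_pred hS) <-> S v.
Proof. by split=> [/asboolP|Sv]; [|apply/asboolP]. Qed.

Lemma in_span_nil v : in_span [::] v <-> v = 0.
Proof.
by split=> [[c ->]|->]; [rewrite big_ord0|exists (fun=> 0); rewrite big_ord0].
Qed.

Lemma in_span_cons a s v :
  in_span (a :: s) v <-> exists c, in_span s (v - c *: a).
Proof.
split=> [[c ->]|[c [c' e]]].
  exists (c 0); exists (fun i => c i.+1).
  by rewrite /= big_ord_recl /= addrC addKr.
exists (fun i => if i is i'.+1 then c' i' else c).
by rewrite /= big_ord_recl /= -e addrC subrK.
Qed.

Lemma in_span_submodp s : submodp (in_span s).
Proof.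
split=> [|a u v [c ->] [c' ->]].
  by exists (fun=> 0); rewrite big1 // => i _; rewrite scale0r.
exists (fun i => a * c i + c' i).
rewrite scaler_sumr -big_split; apply: eq_bigr => i _.
by rewrite scalerDl scalerA.
Qed.

Lemma in_span_mem s v : v \in s -> in_span s v.
Proof.
elim: s => //= a s IH; rewrite inE => /orP [/eqP ->|/IH vs]; apply/in_span_cons.
  by exists 1; rewrite scale1r subrr; case: (in_span_submodp s).
by exists 0; rewrite scale0r subr0.
Qed.

Lemma in_span_sub S s v :
  submodp S -> (forall a, a \in s -> S a) -> in_span s v -> S v.
Proof.
move=> hS Ss [c ->]; apply: submodp_sum => // i.
by apply: submodpZ => //; apply: Ss; rewrite mem_nth.
Qed.

Lemma in_span_trans s t v :
  (forall a, a \in s -> in_span t a) -> in_span s v -> in_span t v.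
Proof. by move=> st; apply: in_span_sub st; exact: in_span_submodp. Qed.

Lemma in_span_subset s t v : {subset s <= t} -> in_span s v -> in_span t v.
Proof. by move=> st; apply: in_span_trans => a /st/in_span_mem. Qed.

Lemma in_span_cat s t v :
  in_span (s ++ t) v <-> exists2 u, in_span s u & in_span t (v - u).
Proof.
split=> [|[u su tv]].
  elim: s v => [|a s IH] v; first by exists 0; [apply/in_span_nil|rewrite subr0].
  rewrite cat_cons => /in_span_cons [c /IH [u su tu]].
  exists (u + c *: a); last by rewrite opprD addrA addrAC.
  by apply/in_span_cons; exists c; rewrite addrK.
rewrite -(subrK u v); apply: submodpD; first exact: in_span_submodp.
  by apply: in_span_subset tv => a; rewrite mem_cat orbC => ->.
by apply: in_span_subset su => a; rewrite mem_cat => ->.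
Qed.

Definition fgen S : Prop := exists s, forall v, S v <-> in_span s v.

Definition noetherian_module : Prop := forall S, submodp S -> fgen S.

Lemma in_seqmod_nil v : in_seqmod (R := R) [::] v <-> v = 0.
Proof.
by split=> [[c ->]|->]; [rewrite big_ord0|exists (fun=> 0); rewrite big_ord0].
Qed.

Lemma in_seqmod_cons a (r : seq R) v :
  in_seqmod (a :: r) v <-> exists u, in_seqmod r (v - a *: u).
Proof.
split=> [[c ->]|[c [c' e]]].
  exists (c 0); exists (fun i => c i.+1).
  by rewrite /= big_ord_recl /= addrC addKr.
exists (fun i => if i is i'.+1 then c' i' else c).
by rewrite /= big_ord_recl /= -e addrC subrK.
Qed.

Lemma in_seqmod_submodp (r : seq R) : submodp (in_seqmod (V := V) r).
Proof.
split=> [|a u v [c ->] [c' ->]].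
  by exists (fun=> 0); rewrite big1 // => i _; rewrite scaler0.
exists (fun i => a *: c i + c' i).
rewrite scaler_sumr -big_split; apply: eq_bigr => i _.
by rewrite scalerDr !scalerA mulrC.
Qed.

Lemma in_seqmod_mem a (r : seq R) v : a \in r -> in_seqmod r (a *: v).
Proof.
elim: r v => //= b r IH v; rewrite inE => /orP [/eqP ->|ar]; apply/in_seqmod_cons.
  by exists v; rewrite subrr; case: (in_seqmod_submodp r).
by exists 0; rewrite scaler0 subr0; exact: IH.
Qed.

Lemma in_seqmod_sub S (r : seq R) v : submodp S ->
  (forall a u, a \in r -> S (a *: u)) -> in_seqmod r v -> S v.
Proof.
move=> hS Sr [w ->]; apply: submodp_sum => // i.
by apply: Sr; rewrite mem_nth.
Qed.


End Submodules.

Lemma in_seqmod_span (R : comNzRingType) (V : lmodType R) (r : seq R) c (v : V) :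
  in_span (r : seq R^o) c -> in_seqmod r (c *: v).
Proof.
have hS := in_seqmod_submodp V r.
apply: (@in_span_sub R R^o (fun c => in_seqmod r (c *: v))) => [|a ar].
  split=> [|a b b' hb hb']; first by rewrite scale0r; case: hS.
  by rewrite scalerDl -scalerA; case: hS => _; apply.
exact: in_seqmod_mem.
Qed.

(** * Linear maps obtained by choice, factorization and division *)

Section LinearConstructions.
Variable R : comNzRingType.
Implicit Types U V W : lmodType R.

(** Compatibility with linear combinations and triviality over 0 make the value at each point
    unique, so any choice function is already linear. *)
Lemma linear_choice U V (rel : U -> V -> Prop) :
    (forall u, exists v, rel u v) ->
    (forall a u u' v v', rel u v -> rel u' v' -> rel (a *: u + u') (a *: v + v')) ->
    (forall v, rel 0 v -> v = 0) ->
  exists f : {linear U -> V}, forall u, rel u (f u).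
Proof.
move=> tot rP r0; have [f fP] := choice tot.
have uniq u v v' : rel u v -> rel u v' -> v = v'.
  move=> h h'; apply/esym/eqP; rewrite -subr_eq0; apply/eqP/r0.
  by have := rP (-1) _ _ _ _ h h'; rewrite !scaleN1r addNr addrC.
have fl : linear f by move=> a u v; apply: uniq (fP _) (rP _ _ _ _ _ (fP _) (fP _)).
pose F := HB.pack_for {linear U -> V} f (GRing.isLinear.Build R U V *:%R f fl).
by exists F.
Qed.

Lemma factor_linear U V W (p : {linear U -> V}) (f : {linear U -> W}) :
    (forall v, exists u, p u = v) -> (forall u, p u = 0 -> f u = 0) ->
  exists g : {linear V -> W}, forall u, g (p u) = f u.
Proof.
move=> ps pf.
have [|a u u' v v' [x <- <-] [y <- <-]|v [x /pf -> <-]//|g gP] :=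
    @linear_choice V W (fun v w => exists2 u, p u = v & f u = w).
- by move=> v; have [u <-] := ps v; exists (f u), u.
- by exists (a *: x + y); rewrite linearP.
exists g => u; have [x px <-] := gP (p u).
by apply/eqP; rewrite -subr_eq0 -linearB; apply/eqP/pf; rewrite linearB px subrr.
Qed.

Definition regular V (a : R) : Prop := forall v : V, a *: v = 0 -> v = 0.

Lemma divide_linear U V a (f : {linear U -> V}) :
    regular V a -> (forall u, exists v, f u = a *: v) ->
  exists g : {linear U -> V}, forall u, f u = a *: g u.
Proof.
move=> reg fa.
apply: (@linear_choice _ _ (fun u v => f u = a *: v)) => // [b u u' v v' e e'|v].
  by rewrite linearP e e' scalerDr !scalerA mulrC.
by rewrite linear0 => /esym /reg.
Qed.

End LinearConstructions.

(** * Quotient modules, in particular [V/aV] *)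

HB.instance Definition _ (R : pzRingType) (V : lmodType R) (S : submodClosed V) :=
  GRing.isLinear.Build R V (quotmod S) *:%R (quotmod_pi S)
    (fun a u v => etrans (quotmod_piD S _ _)
       (congr1 (+%R^~ _) (esym (quotmod_scale_pi S a u)))).

Section Quotients.
Variable R : comNzRingType.
Implicit Types U V W : lmodType R.

Lemma quotmod_pi_surj V (S : submodClosed V) (x : quotmod S) :
  exists v, quotmod_pi S v = x.
Proof. by exists (repr (x : Quotient.quot (oppclosed S))); exact: quotmod_piK. Qed.

Lemma quotmod_pi0 V (S : submodClosed V) v : quotmod_pi S v = 0 <-> v \in S.
Proof. by rewrite -(linear0 (quotmod_pi S)) quotmod_piE subr0. Qed.

Definition homothety V (a : R) : {linear V -> V} := a \*: (idfun : {linear V -> V}).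

Definition modx V (a : R) : lmodType R := quotmod (im (homothety V a)).

Definition modx_pi V a : {linear V -> modx V a} := quotmod_pi (im (homothety V a)).

Lemma modx_pi0 V a v : modx_pi V a v = 0 <-> exists u, v = a *: u.
Proof.
rewrite quotmod_pi0; split=> [/asboolP [u <-]|[u ->]]; first by exists u.
by apply/asboolP; exists u.
Qed.

Lemma modx_pi_surj V a (x : modx V a) : exists v, modx_pi V a v = x.
Proof. exact: quotmod_pi_surj. Qed.

Lemma modx_scale0 V a (x : modx V a) : a *: x = 0.
Proof.
have [v <-] := modx_pi_surj x.
by rewrite -linearZ; apply/modx_pi0; exists v.
Qed.

(** Passing from [V] to [V/aV] removes the head of a sequence; the inductions on regular sequences
    rest on this. *)
Lemma in_seqmod_modx V a (r : seq R) v :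
  in_seqmod r (modx_pi V a v) <-> in_seqmod (a :: r) v.
Proof.
rewrite in_seqmod_cons; split=> [[w e]|[u [w e]]].
  have [w' w'P] := choice (fun i => modx_pi_surj (w i)).
  have [u e'] : exists u, v - \sum_(j < size r) r`_j *: w' j = a *: u.
    apply/modx_pi0; rewrite linearB linear_sum e.
    by under [X in _ - X]eq_bigr do rewrite linearZ w'P; rewrite subrr.
  by exists u, w'; rewrite -e' opprB addrC subrK.
exists (fun i => modx_pi V a (w i)).
under eq_bigr do rewrite -linearZ.
rewrite -linear_sum -e linearB [X in _ - X](_ : _ = 0) ?subr0 //.
by apply/modx_pi0; exists u.
Qed.

Lemma finite_surj V W (f : {linear V -> W}) :
  (forall w, exists v, f v = w) -> finite_module V -> finite_module W.
Proof.
move=> fs [s sP]; exists (map f s) => w; have [v <-] := fs w.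
have [c ->] := sP v; exists c; rewrite linear_sum size_map.
by apply: eq_bigr => i _; rewrite linearZ (nth_map 0).
Qed.

End Quotients.

(** * Noetherian modules *)

Section NoetherianModules.
Variable R : comNzRingType.
Implicit Types U V W : lmodType R.

Lemma noetherian_moduleR : noetherian R -> noetherian_module R^o.
Proof.
move=> noeth S hS; have [s sP] := noeth (submod_pred hS); exists s => v.
by rewrite -(submod_predE hS) sP.
Qed.

Lemma noetherian_module_finite V : noetherian_module V -> finite_module V.
Proof. by move=> /(_ (fun=> True)) [] // s sP; exists s => v; apply/sP. Qed.

Lemma fgen_image V W (f : {linear V -> W}) (S : W -> Prop) : submodp S ->
  fgen (fun v => S (f v)) -> fgen (fun w => S w /\ exists v, f v = w).
Proof.
move=> hS [s sP]; exists (map f s) => w; split=> [[Sw [v e]]|].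
  move: Sw; rewrite -e => /sP [c ->]; exists c.
  by rewrite linear_sum size_map; apply: eq_bigr => i _; rewrite linearZ (nth_map 0).
apply: (in_span_sub (S := fun w => S w /\ exists v, f v = w)) => [|w']; last first.
  move=> /mapP [v /in_span_mem/sP Sv ->].
  by split=> //; exists v.
split=> [|a u v [Su [x fx]] [Sv [y fy]]].
  by split; [case: hS|exists 0; rewrite linear0].
by split; [case: hS => _; apply|exists (a *: x + y); rewrite linearP fx fy].
Qed.

Lemma fgen_iff V (S T : V -> Prop) : (forall v, S v <-> T v) -> fgen S -> fgen T.
Proof. by move=> ST [s sP]; exists s => v; rewrite -ST. Qed.

Lemma submodp_preim V W (f : {linear V -> W}) (S : W -> Prop) :
  submodp S -> submodp (fun v => S (f v)).
Proof.
by move=> [S0 SP]; split=> [|a u v Su Sv]; rewrite ?linear0 // linearP; apply: SP.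
Qed.

(** Lifts of generators of the image of [S] under [p], together with generators of its part in the
    kernel, generate [S]. *)
Lemma fgen_ext V W (p : {linear V -> W}) (S : V -> Prop) :
    noetherian_module W -> submodp S -> fgen (fun v => S v /\ p v = 0) -> fgen S.
Proof.
move=> nW hS [s sP].
have [|t tP] := nW (fun w => exists2 v, S v & p v = w).
  split=> [|a _ _ [u Su <-] [v Sv <-]] /=.
    by exists 0; [case: hS|rewrite linear0].
  by exists (a *: u + v); [case: hS => _; apply|rewrite linearP].
have {}/choice [f fP] : forall w, exists v, w \in t -> S v /\ p v = w.
  move=> w; have [/in_span_mem/tP [v Sv pv]|_] := boolP (w \in t); first by exists v.
  by exists 0.
exists (map f t ++ s) => v; split=> [Sv|].
  have [|c pv] := (tP (p v)).1; first by exists v.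
  apply/in_span_cat; exists (\sum_(i < size t) c i *: (map f t)`_i).
    by exists c; rewrite size_map.
  have fi (i : 'I_(size t)) : S (map f t)`_i /\ p (map f t)`_i = t`_i.
    by rewrite (nth_map 0) //; apply/fP/mem_nth.
  apply/sP; split.
    apply: submodpB => //; apply: submodp_sum => // i.
    by apply: submodpZ => //; case: (fi i).
  rewrite linearB linear_sum pv -sumrB big1 // => i _.
  by rewrite linearZ (fi i).2 subrr.
move=> h; apply: in_span_sub h => // a; rewrite mem_cat => /orP [/mapP [w /fP [Sw _] ->] //|].
by move/in_span_mem/sP; case.
Qed.

Definition multiples V (a : V) (c : R^o) : V := c *: a.

Lemma multiples_linear V (a : V) : linear (multiples a).
Proof. by move=> c u v; rewrite /multiples scalerDl -scalerA. Qed.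

HB.instance Definition _ V (a : V) :=
  GRing.isLinear.Build R R^o V *:%R (multiples a) (multiples_linear a).

(** Induction on the number of generators, for all modules at once, because the step replaces [V] by
    its quotient by the cyclic submodule of the first generator. *)
Lemma finite_noetherian V : noetherian R -> finite_module V -> noetherian_module V.
Proof.
move=> nR; suff H k W (s : seq W) : size s = k -> (forall w, in_span s w) ->
    noetherian_module W by move=> [s sP]; apply: H sP.
elim: k W s => {V} [|k IH] V [|a s] //= sk sP S hS.
  exists [::] => v; split=> [_ //|/in_span_nil ->]; by case: hS.
pose p : {linear V -> _} := quotmod_pi (im (multiples a : {linear R^o -> V})).
have nq : noetherian_module (quotmod (im (multiples a : {linear R^o -> V}))).
  apply: (IH _ (map p s)) => [|x]; first by rewrite size_map; case: sk.
  have [v <-] := quotmod_pi_surj x.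
  have /in_span_cons [c [c' e]] := sP v.
  exists c'; rewrite size_map -[v](subrK (c *: a)) e linearD linear_sum.
  rewrite [X in _ + X](_ : _ = 0); last first.
    by apply/quotmod_pi0/asboolP; exists c.
  by rewrite addr0; apply: eq_bigr => i _; rewrite linearZ (nth_map 0).
apply: (fgen_ext (p := p)) => //.
(* The part of [S] in the cyclic submodule is the image of an ideal of coefficients, which is
   finitely generated. *)
apply: fgen_iff (fgen_image hS (noetherian_moduleR nR
  (submodp_preim (multiples a : {linear R^o -> V}) hS))) => v.
by rewrite quotmod_pi0; split=> -[Sv] => [|/asboolP] h; split=> //; apply/asboolP.
Qed.

Definition hom_eval U V (u : U) (f : lhom U V) : V := f u.

Lemma hom_eval_linear U V (u : U) : linear (@hom_eval U V u).
Proof. by []. Qed.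

HB.instance Definition _ U V (u : U) :=
  GRing.isLinear.Build R (lhom U V) V *:%R (@hom_eval U V u) (hom_eval_linear u).

(** A map is determined by its values at generators of [U], and evaluation at one generator lands in
    [V]; [fgen_ext] deals with the generators one at a time. *)
Lemma noetherian_lhom U V :
  finite_module U -> noetherian_module V -> noetherian_module (lhom U V).
Proof.
move=> [s sP] nV.
suff H (t : seq U) (S : lhom U V -> Prop) : submodp S ->
    fgen (fun f => S f /\ forall u, u \in t -> f u = 0) -> fgen S.
  move=> S hS; apply: (H s) => //; exists [::] => f; rewrite in_span_nil.
  split=> [[_ f0]|->]; last by split=> //; case: hS.
  apply: lhomP => u; have [c ->] := sP u; rewrite linear_sum big1 // => i _.
  by rewrite linearZ /= f0 ?scaler0 ?mem_nth.
elim: t S => [|u t IH] S hS [r rP].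
  exists r => f; rewrite -rP; split=> [Sf|[]//]; by split.
(* The condition [f u = 0] is absorbed into [S] before the induction hypothesis is used. *)
apply: (fgen_ext (p := @hom_eval U V u)) => //; apply: IH.
  split=> [|a f g [Sf fu] [Sg gu]]; first by split; [case: hS|rewrite linear0].
  by split; [case: hS => _; apply|rewrite linearP fu gu scaler0 addr0].
exists r => f; rewrite -rP; split=> [[[Sf fu] ft]|[Sf ft]].
  by split=> // v; rewrite inE => /orP [/eqP -> //|/ft].
split; last by move=> v vt; apply: ft; rewrite inE vt orbT.
by split=> //; apply: ft; rewrite mem_head.
Qed.

Definition pair0 V W (w : W) : V * W := (0, w).

Lemma pair0_linear V W : linear (@pair0 V W).
Proof. by move=> a u v; congr pair; rewrite /= scaler0 addr0. Qed.

HB.instance Definition _ V W :=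
  GRing.isLinear.Build R W (V * W)%type *:%R (@pair0 V W) (@pair0_linear V W).

Lemma noetherian_prod V W :
  noetherian_module V -> noetherian_module W -> noetherian_module (V * W)%type.
Proof.
move=> nV nW S hS; apply: (fgen_ext (p := @fst V W)) => //.
apply: fgen_iff (fgen_image hS (nW _ (submodp_preim (@pair0 V W : {linear W -> (V * W)%type}) hS))).
move=> [v w]; split=> [[Sv [u e]]|[Sv /= v0]]; split=> //.
  by rewrite -e.
by exists w; rewrite v0.
Qed.

End NoetherianModules.

(** * Local rings and Nakayama's lemma *)

Section Ideals.
Variables (R : comNzRingType) (J : R -> Prop).
Hypotheses (hJ : submodp (V := R^o) J) (J1 : ~ J 1).

Definition ideal_pred of submodp (V := R^o) J & ~ J 1 : {pred R} := fun a => `[< J a >].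

Lemma ideal_pred_closed : idealr_closed (ideal_pred hJ J1).
Proof.
split=> [||a u v /asboolP Ju /asboolP Jv]; first by apply/asboolP; case: hJ.
  by apply/asboolP.
by apply/asboolP; case: hJ => _; apply.
Qed.

HB.instance Definition _ := isIdealr.Build R (ideal_pred hJ J1) ideal_pred_closed.

End Ideals.

Section LocalRing.
Variables (R : comNzRingType) (m : idealr R).
Hypothesis hm : local_ring m.

(** Since [local_ring] speaks of maximal ideals alone, Zorn's lemma has to place a non-unit in a
    maximal ideal, which is then [m]. *)
Lemma local_unit a : a \notin m -> exists b, b * a = 1.
Proof.
(* [P J] says that [J] is closed under combinations and that [J + Ra] misses 1. The clause [u = 0]
   is there because [J] may be empty: the union of the empty chain must satisfy [P]. *)
move=> am; apply: contrapT => nunit; pose P (J : R -> Prop) :=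
  (forall c u v, J u -> J v -> J (c * u + v)) /\
  (forall u r, J u \/ u = 0 -> u + r * a <> 1).
have [F FP Ftot|J [[JP J1] Jmax]] := @classical_sets.Zorn_bigcup R P.
  split=> [c u v [X FX Xu] [Y FY Yv]|u r [[X FX Xu]|->]].
  - have [XY|YX] := Ftot _ _ FX FY.
      by exists Y => //; apply: (FP _ FY).1 => //; apply: XY.
    by exists X => //; apply: (FP _ FX).1 => //; apply: YX.
  - by apply: (FP _ FX).2; left.
  - by rewrite add0r => e; apply: nunit; exists r.
pose J' b := exists u r, (J u \/ u = 0) /\ b = u + r * a.
have hJ' : submodp (V := R^o) J'.
  split=> [|c _ _ [u [r [Ju ->]]] [v [t [Jv ->]]]].
    by exists 0, 0; rewrite mul0r addr0; split=> //; right.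
  exists (c * u + v), (c * r + t); split; last first.
    by rewrite [LHS]/(_ + _) mulrDl -mulrA /= /GRing.scale /= mulrDr addrACA.
  case: Ju Jv => [Ju|->] [Jv|->]; [left|left|left|right].
  - exact: JP.
  - by rewrite addr0 -(subrK 1 c) mulrDl mul1r; apply: JP.
  - by rewrite mulr0 add0r.
  - by rewrite mulr0 addr0.
have J'1 : ~ J' 1 by move=> [u [r [Ju /esym]]]; apply: J1.
pose M : idealr R := ideal_pred hJ' J'1.
have Ma : a \in M.
  by apply/asboolP; exists 0, 1; rewrite mul1r add0r; split=> //; right.
(* An ideal [L] above [M] is proper and contains [a], hence satisfies [P]; an element of [L] outside
   [M] would make it strictly larger than [J]. *)
have Mmax : maximal_ideal M.
  move=> L ML b Lb; apply: contrapT => nMb.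
  apply: (Jmax (fun u => u \in L)); last first.
    split=> [c u v /= Lu Lv|u r Lu e]; first by rewrite rpredD // idealMr.
    suff : 1 \in L by rewrite idealr1.
    rewrite -e rpredD ?idealMr //; last exact: ML.
    by case: Lu => [//|->]; rewrite rpred0.
  split=> [|/(_ b Lb) Jb]; last first.
    by apply: nMb; apply/asboolP; exists b, 0; rewrite mul0r addr0; split=> //; left.
  move=> u Ju; apply: ML; apply/asboolP; exists u, 0.
  by rewrite mul0r addr0; split=> //; left.
by move: am; rewrite -(hm.2 _ Mmax) Ma.
Qed.

Lemma local_unit1B a : a \in m -> exists b, b * (1 - a) = 1.
Proof.
move=> am; apply: local_unit; apply/negP => am1.
by have := rpredD am1 am; rewrite subrK idealr1.
Qed.

Section Nakayama.
Variable V : lmodType R.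
Implicit Types (N : V -> Prop) (s : seq V).

(* Membership in the submodule [N + m * span s]. *)
Fixpoint in_mspan N s (v : V) : Prop :=
  if s is u :: s' then exists2 c, c \in m & in_mspan N s' (v - c *: u) else N v.

Lemma in_mspan_submodp N s : submodp N -> submodp (in_mspan N s).
Proof.
move=> hN; elim: s => //= u s [s0 sP]; split=> [|a v w [c cm vc] [d dm wd]].
  by exists 0; rewrite ?rpred0 // scale0r subr0.
exists (a * c + d); first by rewrite rpredD // idealMr.
by rewrite scalerDl opprD addrACA -scalerA -scalerBr; apply: sP.
Qed.

Lemma in_mspan_base N s v : N v -> in_mspan N s v.
Proof.
elim: s v => //= u s IH v Nv; exists 0; rewrite ?rpred0 // scale0r subr0; exact: IH.
Qed.

Lemma in_mspan_scale N s a v :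
  submodp N -> a \in m -> in_span s v -> in_mspan N s (a *: v).
Proof.
move=> hN am; elim: s v => [|u s IH] v /=.
  by move/in_span_nil ->; rewrite scaler0; case: hN.
case/in_span_cons => c /IH vs; exists (a * c); first by rewrite mulrC idealMr.
by rewrite -scalerA -scalerBr.
Qed.

Lemma in_mspan_sum N (J : Type) (r : seq J) (F : J -> V) (c : J -> R) v :
    (forall j, c j \in m) -> N (v - \sum_(j <- r) c j *: F j) ->
  in_mspan N (map F r) v.
Proof.
move=> cm; elim: r v => [|j r IH] v /=; first by rewrite big_nil subr0.
rewrite big_cons opprD addrA => Nv.
by exists (c j) => //; apply: IH.
Qed.

Lemma in_mspan_sub N s v :
  submodp N -> (forall u, u \in s -> N u) -> in_mspan N s v -> N v.
Proof.
move=> hN; elim: s v => //= w s IH v sN [c _ e].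
rewrite -(subrK (c *: w) v); apply: submodpD => //.
  by apply: IH e => x xs; apply: sN; rewrite inE xs orbT.
by apply: submodpZ => //; apply: sN; rewrite mem_head.
Qed.

(** Generators are eliminated one at a time: in the relation for the first generator [u] its own
    coefficient [c] lies in [m], so [1 - c] is a unit and [u] falls into [N] plus [m] times the span
    of the others. *)
Lemma nakayama N s :
  submodp N -> (forall v, v \in s -> in_mspan N s v) -> forall v, v \in s -> N v.
Proof.
move=> hN; elim: s => //= u s IH sP.
have hs := in_mspan_submodp s hN.
have us : in_mspan N s u.
  have [c /local_unit1B [b bc] e] := sP u (mem_head _ _).
  rewrite -[u]scale1r -bc -scalerA; apply: submodpZ => //.
  by rewrite scalerBl scale1r.
have sN v : v \in s -> N v.
  apply: IH => {}v vs; have [|c _ e] := sP v; first by rewrite inE vs orbT.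
  by rewrite -(subrK (c *: u) v); apply: submodpD => //; apply: submodpZ.
move=> v; rewrite inE => /orP [/eqP ->|/sN //].
exact: in_mspan_sub us.
Qed.

Lemma nakayama_seqmod (r : seq R) (v : V) :
  finite_module V -> all [in m] r -> (forall u : V, in_seqmod r u) -> v = 0.
Proof.
move=> [g gP] rm rV.
have h0 : submodp (fun u : V => u = 0).
  by split=> // a u w -> ->; rewrite scaler0 addr0.
apply: (in_span_sub h0 _ (gP v)); apply: nakayama => // u _.
apply: (in_seqmod_sub _ _ (rV u)); first exact: in_mspan_submodp.
by move=> a w /(allP rm) am; apply: in_mspan_scale.
Qed.

End Nakayama.

End LocalRing.

(** * Koszul cohomology *)

Section Koszul.
Variables (R : comNzRingType).
Implicit Types (V W : lmodType R) (s : seq R) (i j : nat).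

(* [koszul V s i.+1] is the Koszul cochain module of degree [i]; the shift by one
   makes degree 0 the zero module, which spares every case split on the lowest
   degree. *)
Fixpoint koszul V s i {struct s} : lmodType R :=
  match s, i with
  | [::], 1 => V
  | [::], _ => 'rV[R]_0
  | _ :: _, 0 => 'rV[R]_0
  | _ :: s', i'.+1 => (koszul V s' i'.+1 * koszul V s' i')%type
  end.

(** A pair splits a cochain into the part free of the basis vector of [a] and the coefficient of
    that vector; the differential is that of the shifted cone of multiplication by [a]. *)
Fixpoint koszul_d V s i {struct s} : koszul V s i -> koszul V s i.+1 :=
  match s return koszul V s i -> koszul V s i.+1 with
  | [::] => fun=> 0
  | a :: s' =>
    match i return koszul V (a :: s') i -> koszul V (a :: s') i.+1 with
    | 0 => fun=> 0
    | i'.+1 => fun z => (koszul_d z.1, a *: z.1 - koszul_d z.2)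
    end
  end.

Lemma koszul_d_linear V s i : linear (@koszul_d V s i).
Proof.
elim: s i => [|a s IH] [|i] c u v; rewrite /= ?scaler0 ?addr0 //.
congr pair; first by rewrite /= IH.
rewrite /= IH scalerDr scalerBr !scalerA mulrC opprD addrACA; congr (_ + _).
Qed.

HB.instance Definition _ V s i :=
  GRing.isLinear.Build R (koszul V s i) (koszul V s i.+1) *:%R
    (@koszul_d V s i) (@koszul_d_linear V s i).

Lemma koszul0 V s (z : koszul V s 0) : z = 0.
Proof. by case: s z => [|a s] z; apply: thinmx0. Qed.

Lemma koszul_above V s i (z : koszul V s i) : ((size s).+1 < i)%N -> z = 0.
Proof.
elim: s i z => [|a s IH] [|[|i]] //= z lt_i; first exact: thinmx0.
by case: z => u v; rewrite [u]IH ?[v]IH // ltnW.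
Qed.

Lemma koszul_ddE V s i (z : koszul V s i) : koszul_d (koszul_d z) = 0.
Proof.
elim: s i z => [|a s IH] [|i] z //=; first by rewrite !linear0 addr0.
by congr pair; rewrite /= ?IH // linearB linearZ /= IH subr0 subrr.
Qed.

Fixpoint koszul_map V W (f : V -> W) s i {struct s} : koszul V s i -> koszul W s i :=
  match s return koszul V s i -> koszul W s i with
  | [::] => match i return koszul V [::] i -> koszul W [::] i with
            | 0 => id | 1 => f | _ => id end
  | a :: s' =>
    match i return koszul V (a :: s') i -> koszul W (a :: s') i with
    | 0 => id
    | i'.+1 => fun z => (koszul_map f z.1, koszul_map f z.2)
    end
  end.

Lemma koszul_map_linear V W (f : {linear V -> W}) s i : linear (@koszul_map V W f s i).
Proof.
elim: s i => [|a s IH] [|i] c u v //=; first by case: i u v => //= u v; rewrite linearP.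
by congr pair; rewrite /= IH.
Qed.

HB.instance Definition _ V W (f : {linear V -> W}) s i :=
  GRing.isLinear.Build R (koszul V s i) (koszul W s i) *:%R
    (@koszul_map V W f s i) (@koszul_map_linear V W f s i).

Lemma koszul_map_d V W (f : {linear V -> W}) s i (z : koszul V s i) :
  koszul_map f (koszul_d z) = koszul_d (koszul_map f z).
Proof.
elim: s i z => [|a s IH] [|i] z //=; first by rewrite linear0.
  by congr pair; rewrite linear0.
by congr pair; rewrite /= ?IH // linearB linearZ /= IH.
Qed.

Lemma koszul_map_surj V W (f : {linear V -> W}) s i (z : koszul W s i) :
  (forall w, exists v, f v = w) -> exists y, koszul_map f (s := s) (i := i) y = z.
Proof.
move=> fs; elim: s i z => [|a s IH] [|i] //= z; try by exists z.
  by case: i z => [|i] z; [apply: fs|exists z].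
have [[u eu] [v ev]] := (IH _ z.1, IH _ z.2).
by exists (u, v); case: z eu ev => z1 z2 /= -> ->.
Qed.

Lemma koszul_map_ker V W (f : {linear V -> W}) a s i (z : koszul V s i) :
    (forall v, f v = 0 -> exists u, v = a *: u) ->
  koszul_map f z = 0 -> exists y, z = a *: y.
Proof.
move=> fa; elim: s i z => [|b s IH] [|i] z /= fz; try by exists 0; rewrite fz scaler0.
  case: i z fz => [|i] z /= fz; first exact: fa.
  by exists 0; rewrite fz scaler0.
case: z fz => u v [/IH [x ->] /IH [y ->]].
by exists (x, y).
Qed.

Lemma koszul_regular V a s i : regular V a -> regular (koszul V s i) a.
Proof.
move=> reg; elim: s i => [|b s IH] [|i] z /=; try by rewrite [z]thinmx0.
  by case: i z => [|i] z; [apply: reg|rewrite [z]thinmx0].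
by case: z => u v [/IH -> /IH ->].
Qed.

Lemma koszul_scale0 V a s i (z : koszul V s i) : (forall v : V, a *: v = 0) -> a *: z = 0.
Proof.
move=> a0; elim: s i z => [|b s IH] [|i] z /=; try by rewrite [LHS]thinmx0.
  by case: i z => [|i] z; [apply: a0|rewrite [LHS]thinmx0].
by case: z => u v; congr pair; apply: IH.
Qed.

Lemma koszul_noetherian V s i : noetherian_module V -> noetherian_module (koszul V s i).
Proof.
move=> nV; have n0 : noetherian_module 'rV[R]_0.
  move=> S hS; exists [::] => v; rewrite in_span_nil [v]thinmx0.
  by split=> // _; case: hS.
elim: s i => [|a s IH] [|i] //=; first by case: i.
exact: noetherian_prod.
Qed.

(* Interior product by the dual basis vector of the first occurrence of [b]. *)
Fixpoint koszul_h V (b : R) s i {struct s} : koszul V s i.+1 -> koszul V s i :=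
  match s return koszul V s i.+1 -> koszul V s i with
  | [::] => fun=> 0
  | a :: s' =>
    match i return koszul V (a :: s') i.+1 -> koszul V (a :: s') i with
    | 0 => fun=> 0
    | i'.+1 => fun z =>
      if a == b then (z.2, 0) else (koszul_h b z.1, - koszul_h b z.2)
    end
  end.

Lemma koszul_h_linear V b s i : linear (@koszul_h V b s i).
Proof.
elim: s i => [|a s IH] [|i] c u v; rewrite /= ?scaler0 ?addr0 //.
case: eqP => _; congr pair; rewrite /= ?scaler0 ?addr0 ?IH //.
by rewrite opprD scalerN.
Qed.

HB.instance Definition _ V b s i :=
  GRing.isLinear.Build R (koszul V s i.+1) (koszul V s i) *:%R
    (@koszul_h V b s i) (@koszul_h_linear V b s i).

(** Multiplication by an entry of [s] is null-homotopic, with [koszul_h b] as homotopy; every entry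
    therefore annihilates the cohomology. *)
Lemma koszul_homotopy V s b i (z : koszul V s i.+1) : b \in s ->
  b *: z = koszul_d (koszul_h b z) + koszul_h b (koszul_d z).
Proof.
elim: s i z => //= a s IH i [u v].
rewrite inE eq_sym; case: (eqVneq a b) => [-> _|ab /= bs].
  case: i u v => [|i] u v /=; congr pair => /=.
  - by rewrite [v]koszul0 linear0 subr0 add0r.
  - by rewrite [RHS]koszul0 [LHS]koszul0.
  - by rewrite addrC subrK.
  - by rewrite linear0 subr0 addr0.
case: i u v => [|i] u v /=; congr pair => /=.
- by rewrite IH // [koszul_h b u]koszul0 linear0.
- by rewrite [RHS]koszul0 [LHS]koszul0.
- exact: IH.
rewrite (IH i v bs) !linearN !linearB linearZ /=.
by rewrite !opprK addrACA subrr add0r.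
Qed.

Lemma koszul_annihilated V s c i (z : koszul V s i.+1) :
    in_span (s : seq R^o) c -> koszul_d z = 0 ->
  exists y : koszul V s i, koszul_d y = c *: z.
Proof.
move=> cs dz; pose S (c : R^o) := exists y : koszul V s i, koszul_d y = c *: z.
apply: (in_span_sub (S := S)) cs => [|b bs].
  split=> [|a u v [y ey] [x ex]]; first by exists 0; rewrite linear0 scale0r.
  by exists (a *: y + x); rewrite [LHS]linearP /= ey ex [RHS]scalerDl scalerA.
by exists (koszul_h b z); rewrite koszul_homotopy // dz linear0 addr0.
Qed.

(* Exactness in degrees below [j] (recall the shift in [koszul]). *)
Definition koszul_exact V s j : Prop := forall i, (i < j)%N ->
  forall z : koszul V s i.+1, koszul_d z = 0 -> exists y : koszul V s i, koszul_d y = z.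

(** If [a *: y] is the coboundary of [w], then [w] is a cocycle modulo [a], so
    [w = koszul_d x' + a *: t], and regularity gives [koszul_d t = y]. Thus [a] acts injectively on
    cohomology in this range, while [a ^+ k] acts as zero. *)
Lemma koszul_exact_modx V s a k j :
    regular V a -> in_span (s : seq R^o) (a ^+ k) ->
  koszul_exact (modx V a) s j -> koszul_exact V s j.+1.
Proof.
move=> reg ak ex i lt_ij z dz.
have key y : koszul_d y = 0 -> (exists x : koszul V s i, koszul_d x = a *: y) ->
    exists x : koszul V s i, koszul_d x = y.
  (* In the lowest degree [w] lives in the zero module, so [a *: y = 0]. *)
  move=> dy [w ew]; case: i => [|i] in lt_ij z dz y dy w ew *.
    exists 0; rewrite linear0; apply/esym/koszul_regular; first exact: reg.
    by rewrite -ew [w]koszul0 linear0.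
  have [|x ex'] := ex i lt_ij (koszul_map (modx_pi V a) w).
    by rewrite -koszul_map_d ew linearZ; apply: koszul_scale0; apply: modx_scale0.
  have [x' ex''] := koszul_map_surj x (@modx_pi_surj _ V a).
  have [||t et] := @koszul_map_ker _ _ (modx_pi V a) a _ _ (w - koszul_d x').
  - by move=> v /modx_pi0.
  - by rewrite linearB /= koszul_map_d ex'' ex' subrr.
  exists t; apply/eqP; rewrite -subr_eq0; apply/eqP/(koszul_regular reg).
  have : koszul_d (a *: t) = a *: y by rewrite -et linearB /= koszul_ddE subr0 ew.
  by rewrite linearZ /= scalerBr => ->; rewrite subrr.
have : exists y : koszul V s i, koszul_d y = a ^+ k *: z by apply: koszul_annihilated.
elim: k {ak} => [|k IH]; first by rewrite scale1r.
rewrite exprS -scalerA => h; apply/IH/key => //.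
by rewrite linearZ /= dz scaler0.
Qed.

(** This identifies the top cochains with [V] and the coboundaries among them with [sV]
    ([koszul_top_d], [koszul_top_im]), so the top cohomology is [V/sV]. *)
Fixpoint koszul_top V s : koszul V s (size s).+1 -> V :=
  match s return koszul V s (size s).+1 -> V with
  | [::] => id
  | a :: s' => fun z => koszul_top z.2
  end.

Lemma koszul_top_linear V s : linear (@koszul_top V s).
Proof. by elim: s => //= a s IH c u v; rewrite /= IH. Qed.

HB.instance Definition _ V s :=
  GRing.isLinear.Build R (koszul V s (size s).+1) V *:%R
    (@koszul_top V s) (@koszul_top_linear V s).

Lemma koszul_top_surj V s v : exists z, @koszul_top V s z = v.
Proof.
elim: s => [|a s [z <-]]; first by exists v.
by exists (0, z).
Qed.

Lemma koszul_top_inj V s z : @koszul_top V s z = 0 -> z = 0.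
Proof.
elim: s z => //= a s IH [u v] /= /IH ->; congr pair.
exact: koszul_above.
Qed.

Lemma koszul_top_d V s (y : koszul V s (size s)) : in_seqmod s (koszul_top (koszul_d y)).
Proof.
elim: s y => [|a s IH] y; first by apply/in_seqmod_nil.
rewrite /= linearB linearZ /=; apply/in_seqmod_cons; exists (koszul_top y.1).
rewrite addrC addKr; apply: submodpN; first exact: in_seqmod_submodp.
exact: IH.
Qed.

Lemma koszul_top_im V s v : in_seqmod s v ->
  exists y : koszul V s (size s), koszul_top (koszul_d y) = v.
Proof.
elim: s v => [|a s IH] v; first by move/in_seqmod_nil ->; exists 0.
move=> /in_seqmod_cons [u /IH [y e]]; have [z ez] := koszul_top_surj s u.
by exists (z, - y); rewrite /= linearN opprK linearD linearZ /= ez e addrC subrK.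
Qed.

(** The first clause of [regular_seq], isolated because it propagates through [V/aV] by itself; that
    [V] differs from [sV] is left to Nakayama's lemma. *)
Definition weakly_regular V s : Prop := forall i (v : V), (i < size s)%N ->
  in_seqmod (take i s) (s`_i *: v) -> in_seqmod (take i s) v.

Lemma weakly_regular_cons V a s :
  weakly_regular V (a :: s) <-> regular V a /\ weakly_regular (modx V a) s.
Proof.
split=> [reg|[rega regs] [|i] v /= lt_is].
- split=> [v av|i x lt_is]; first by apply/in_seqmod_nil/(reg 0%N) => //; apply/in_seqmod_nil.
  have [v <-] := modx_pi_surj x; rewrite -linearZ !in_seqmod_modx.
  exact: (reg i.+1).
- by rewrite !in_seqmod_nil; apply: rega.
by rewrite -!in_seqmod_modx linearZ; apply: regs.
Qed.

Lemma weakly_regular_rcons V s a :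
    weakly_regular V s -> (forall v : V, in_seqmod s (a *: v) -> in_seqmod s v) ->
  weakly_regular V (rcons s a).
Proof.
move=> regs rega i v; rewrite size_rcons ltnS leq_eqVlt nth_rcons -cats1.
case: eqP => [-> _|_ /= lt_is]; first by rewrite ltnn take_size_cat //; apply: rega.
by rewrite lt_is takel_cat 1?ltnW //; apply: regs.
Qed.

Lemma in_seqmod_subset V s t (v : V) : {subset s <= t} -> in_seqmod s v -> in_seqmod t v.
Proof.
move=> st; apply: in_seqmod_sub; first exact: in_seqmod_submodp.
by move=> a u /st; apply: in_seqmod_mem.
Qed.

(** Each entry of [t] contributes one degree through [koszul_exact_modx], starting from an empty
    range of degrees. *)
Lemma weakly_regular_koszul_exact V s t : weakly_regular V t ->
  (forall a, a \in t -> exists k, in_span (s : seq R^o) (a ^+ k)) -> koszul_exact V s (size t).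
Proof.
elim: t V => [|a t IH] V //= /weakly_regular_cons [rega regt] ts.
have [k ak] := ts a (mem_head _ _).
apply: koszul_exact_modx rega ak _; apply: IH => // b bt.
by apply: ts; rewrite inE bt orbT.
Qed.

Lemma koszul_exact_top V s (v : V) : koszul_exact V s (size s).+1 -> in_seqmod s v.
Proof.
move=> /(_ _ (ltnSn _)) ex; have [z <-] := koszul_top_surj s v.
have [|y <-] := ex z; first exact: koszul_above.
exact: koszul_top_d.
Qed.

Lemma koszul_d_fst V a s i (x : koszul V (a :: s) i) :
  exists u : koszul V s i, fst (koszul_d x : koszul V s i.+1 * koszul V s i) = koszul_d u.
Proof.
case: i x => [|i] x; last by exists x.1.
by exists 0; rewrite [RHS]linear0.
Qed.

(** The list comes out reversed because the induction peels off the head [a] and shows it regular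
    modulo the tail, which places it last. *)
Lemma koszul_exact_weakly_regular (m : idealr R) V s :
    local_ring m -> noetherian_module V -> all [in m] s ->
  koszul_exact V s (size s) -> weakly_regular V (rev s).
Proof.
move=> hm nV; elim: s => [|a s IH] //= /andP [am sm] ex.
rewrite rev_cons; apply: weakly_regular_rcons.
  apply: IH => // i lt_is z dz.
  have [g gP] : fgen (fun z : koszul V s i.+1 => koszul_d z = 0).
    have nK := @koszul_noetherian V s i.+1 nV; apply: nK.
    by split=> [|c u v du dv]; rewrite ?linear0 // linearP /= du dv scaler0 addr0.
  pose B (z : koszul V s i.+1) := exists y : koszul V s i, koszul_d y = z.
  have hB : submodp B.
    split=> [|c _ _ [u <-] [v <-]]; first by exists 0; rewrite linear0.
    by exists (c *: u + v); rewrite linearP.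
  suff gB u : u \in g -> B u by apply/(in_span_sub hB gB)/gP.
  apply: (nakayama hm) => // {}u /in_span_mem/gP du.
  (* A cocycle [u] over [s] gives the cocycle [(0, u)] over [a :: s]. Writing it as a coboundary
     shows [u = a *: y - koszul_d w] with [y] a cocycle, so cocycles are [a] times cocycles plus
     coboundaries, and Nakayama's lemma applies. *)
  have [||[y w] [dy dw]] := ex i.+1 _ ((0, u) : koszul V (a :: s) i.+2).
  - by rewrite ltnS.
  - by rewrite /= linear0 scaler0 du subrr.
  have /gP yg : koszul_d y = 0 by exact: dy.
  rewrite -dw; apply: submodpB; first exact: in_mspan_submodp.
    exact: in_mspan_scale.
  by apply: in_mspan_base; exists w.
move=> v /(in_seqmod_subset (t := s)) av.
apply: (in_seqmod_subset (s := s)) => [b|]; first by rewrite mem_rev.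
have [|y ey] := koszul_top_im (v := a *: v) (s := s).
  by apply: av => b; rewrite mem_rev.
have [z ez] := koszul_top_surj s v.
(* Membership of [a *: v] in [sV] makes [(z, y)] a cocycle. The first component of a coboundary over
   [a :: s] is a coboundary over [s], which puts [v] in [sV]. *)
have [||x ex'] := ex (size s) _ ((z, y) : koszul V (a :: s) (size s).+1).
- by [].
- congr pair; first exact: koszul_above.
  by apply: koszul_top_inj; rewrite linearB linearZ /= ez ey subrr.
have [u du] := koszul_d_fst x.
by rewrite -ez -[z]/((z, y).1) -ex' du; apply: koszul_top_d.
Qed.

End Koszul.

Local Notation cover := Defs.cover.

(** * Lifting homomorphisms when Ext vanishes *)

Section Lifting.
Variable R : comNzRingType.
Implicit Types (M N S : lmodType R) (s : seq R).

Definition cover_map S N (F : S -> N) : cover S -> N := fglift F.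

Lemma cover_map_zmod S N (F : S -> N) : zmod_morphism (cover_map F).
Proof. exact: lift_is_additive. Qed.

HB.instance Definition _ S N (F : S -> N) :=
  GRing.isZmodMorphism.Build (cover S) N (cover_map F) (cover_map_zmod F).

Lemma cover_mapE S N (F : S -> N) (D : cover S) :
  cover_map F D = \sum_(x <- dom D) coeff x D *: F x.
Proof.
rewrite -[in LHS](freeg_sumE D) (raddf_sum (cover_map F)).
by apply: eq_bigr => x _; exact: liftU.
Qed.

Lemma cover_map_scalable S N (F : S -> N) : scalable (cover_map F).
Proof.
move=> a D; rewrite [in RHS]cover_mapE scaler_sumr (raddf_sum (cover_map F)).
by apply: eq_bigr => x _; rewrite scalerA; exact: liftU.
Qed.

HB.instance Definition _ S N (F : S -> N) :=
  GRing.isScalable.Build R (cover S) N *:%R (cover_map F) (cover_map_scalable F).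

Lemma cover_lift S N N' (q : {linear N -> N'}) (h : {linear cover S -> N'}) :
    (forall y, exists x, q x = y) ->
  exists g : {linear cover S -> N}, forall D, q (g D) = h D.
Proof.
move=> qs; have [F FP] := choice (fun x => qs (h << x >>)).
exists (cover_map F) => D /=; rewrite -[in RHS](freeg_sumE D) cover_mapE !linear_sum.
apply: eq_bigr => x _; rewrite linearZ FP.
have -> : << coeff x D *g x >> = coeff x D *: << x >> :> cover S.
  by apply/eqP/freeg_eqP => y; rewrite coeff_fgscale !coeffU mul1r.
by rewrite linearZ.
Qed.

(* [Ext^1(S, N) = 0], read off the presentation of [S] by [cover S]. *)
Definition extends_to_cover S N : Prop :=
  forall g : {linear submod (ker (@aug R S)) -> N},
  exists h : {linear cover S -> N}, forall k, h (val k) = g k.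

(** By dimension shifting, [Ext^1] of the [i]-th syzygy is [Ext^(i+1)] of [M], so the degrees
    recorded are 1 to [n]. *)
Definition ext_vanish M N (n : nat) : Prop :=
  forall i, (i < n)%N -> extends_to_cover (syzygy M i) N.

Lemma ext_vanish_Ext M N n :
  (forall i, (1 <= i <= n)%N -> forall e : Ext M N i, e = 0) -> ext_vanish M N n.
Proof.
move=> ext0 i lt_in g.
(* Composed with the augmentation, [g] becomes a cocycle of degree [i.+1]; exhibiting it as a
   coboundary yields a map on the cover of the [i]-th syzygy, the extension sought. *)
pose z : coch M N i.+1 := (g \o @aug R (syzygy M i.+1) : {linear res M i.+1 -> N}).
have zc : z \in ker (coch_d M N i.+1).
  apply/eqP/lhomP => D /=.
  have -> : aug (res_d M i.+1 D) = 0 by exact/eqP/(valP (aug D)).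
  by rewrite linear0.
have /quotmod_pi0/asboolP [h hP] := ext0 i.+1 lt_in
  (quotmod_pi (@coboundaries R M N i.+1) (Sub z zc)).
exists h => k; have [D <-] := aug_surj k.
by have := congr1 (fun f : lhom _ _ => f D) hP.
Qed.

(** Freeness of the cover lifts [h] to a map [g] on it, whose values on the kernel of [aug] lie in
    [aN]. Dividing these by [a] and extending the result to a map [t] on the cover, the difference
    [g - a t] kills the kernel and descends to [S]. *)
Lemma hom_lift S N a (h : {linear S -> modx N a}) :
    regular N a -> extends_to_cover S N ->
  exists g : {linear S -> N}, forall u, modx_pi N a (g u) = h u.
Proof.
move=> reg ext.
have [g gP] := cover_lift (h \o @aug R S) (@modx_pi_surj R N a).
pose incl : {linear submod (ker (@aug R S)) -> cover S} := val.
have [k|g' g'P] := divide_linear (f := g \o incl) reg.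
  by apply/modx_pi0; rewrite [LHS]gP /= (eqP (valP k)) linear0.
have [t tP] := ext g'.
pose f : {linear cover S -> N} := g \- (a \*: t).
have [||p pP] := @factor_linear _ _ _ _ (@aug R S) f.
- exact: aug_surj.
- move=> D /eqP D0; pose k : submod (ker (@aug R S)) := Sub D D0.
  have := g'P k; rewrite -tP /= => gk.
  by rewrite /= -[D]/(val k) gk subrr.
exists p => u; have [D <-] := aug_surj u.
rewrite pP linearB gP /= [X in _ - X](_ : _ = 0) ?subr0 //.
by apply/modx_pi0; exists (t D).
Qed.

(** A map from the next syzygy to [N/aN] lifts to [N], is extended there and then reduced modulo
    [a]; the lifting consumes one degree of vanishing. *)
Lemma ext_vanish_modx M N a n :
  regular N a -> ext_vanish M N n.+1 -> ext_vanish M (modx N a) n.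
Proof.
move=> reg ext i lt_in g.
have [g' g'P] := hom_lift g reg (ext i.+1 lt_in).
have [h hP] := ext i (ltnW lt_in) g'.
by exists (modx_pi N a \o h) => k; rewrite /= hP g'P.
Qed.

Lemma lhom_sumE M N (J : Type) (r : seq J) (F : J -> lhom M N) u :
  (\sum_(j <- r) F j : lhom M N) u = \sum_(j <- r) F j u.
Proof. exact: (linear_sum (@hom_eval R M N u)). Qed.

(** Modulo [a], induction writes [f] as a combination of maps to [N/aN]. These lift to [N], and the
    remainder, with values in [aN], is divided by [a]. *)
Lemma hom_in_seqmod M N s (f : lhom M N) :
    weakly_regular N s -> ext_vanish M N (size s).-1 ->
  (forall u, in_seqmod s (f u)) -> in_seqmod s f.
Proof.
elim: s N f => [|a s IH] N f /= regs ext fs.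
  by apply/in_seqmod_nil/lhomP => u; apply/in_seqmod_nil.
have [rega {}regs] := (weakly_regular_cons N a s).1 regs.
have [w wP] : in_seqmod s (modx_pi N a \o f : lhom M (modx N a)).
  apply: IH => // [|u]; last by apply/in_seqmod_modx.
  by case: (size s) ext => // n; apply: ext_vanish_modx.
have [w' w'P] : exists w' : nat -> lhom M N, forall j : 'I_(size s),
    forall u, modx_pi N a (w' j u) = w j u.
  (* With an empty tail there is nothing to lift; this accounts for the predecessor in
     [(size s).-1]. *)
  case: s ext {fs wP regs IH} => [|b s] ext; first by exists (fun=> 0) => -[].
  have /choice [w' w'P] : forall j, exists g : lhom M N,
      forall u, modx_pi N a (g u) = w j u.
    by move=> j; apply: hom_lift => //; apply: (ext 0%N).
  by exists w'.
pose r : lhom M N := \sum_(j < size s) s`_j *: w' j.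
have [u|g gP] := divide_linear (f := f - r : lhom M N) rega.
  apply/modx_pi0; rewrite [X in modx_pi _ _ X](_ : _ = f u - r u) // linearB.
  have := congr1 (fun h : lhom _ _ => h u) wP; rewrite /r !lhom_sumE /= => ->.
  by rewrite linear_sum -sumrB big1 // => j _; rewrite linearZ /= w'P subrr.
apply/in_seqmod_cons; exists (g : lhom M N), w'.
apply: lhomP => u; have {gP} := gP u; rewrite /= => gP.
by rewrite -[LHS]/(f u - a *: g u) -gP opprB addrC subrK.
Qed.

(** The quotient [N/sN] is given by an arbitrary surjection [q] with the right kernel, so that the
    induction can replace [N] by [N/aN] and keep the target [N']. *)
Lemma hom_lift_seqmod M N N' s (q : {linear N -> N'}) (h : {linear M -> N'}) :
    weakly_regular N s -> ext_vanish M N (size s) ->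
    (forall y, exists x, q x = y) -> (forall v, q v = 0 <-> in_seqmod s v) ->
  exists g : {linear M -> N}, forall u, q (g u) = h u.
Proof.
elim: s N q => [|a s IH] N q /= regs ext qs qs0.
  have [||p pP] := @factor_linear _ _ _ _ q (idfun : {linear N -> N}) => //.
    by move=> v /qs0/in_seqmod_nil.
  exists (p \o h) => u /=; have [v <-] := qs (h u).
  by rewrite pP.
have [rega {}regs] := (weakly_regular_cons N a s).1 regs.
have [||p pP] := @factor_linear _ _ _ _ (modx_pi N a) q.
- exact: modx_pi_surj.
- move=> v /modx_pi0 [u ->]; apply/qs0/in_seqmod_mem/mem_head.
have [|y|v|g gP] := IH (modx N a) p regs.
- exact: ext_vanish_modx.
- by have [v <-] := qs y; exists (modx_pi N a v).
- by have [w <-] := modx_pi_surj v; rewrite pP in_seqmod_modx.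
have [g' g'P] := hom_lift g rega (ext 0%N (ltn0Sn _)).
by exists g' => u; rewrite -pP g'P gP.
Qed.

End Lifting.

(** * Freeness modulo an ideal *)

Section FreeModulo.
Variables (R : comNzRingType).
Implicit Types (I m : idealr R) (F V X Z : lmodType R).

Lemma in_span_uniq V (s : seq V) v :
  uniq s -> in_span s v -> exists c : V -> R, v = \sum_(b <- s) c b *: b.
Proof.
elim: s v => [|a s IH] v /=; first by move=> _ /in_span_nil ->; exists (fun=> 0); rewrite big_nil.
case/andP=> as_ us /in_span_cons [c /(IH _ us) [c' e]].
exists (fun b => if b == a then c else c' b); rewrite big_cons eqxx.
rewrite -[v](subrK (c *: a)) e addrC; congr (_ + _); apply: eq_big_seq => b bs.
by case: eqP => // ba; rewrite -ba bs in as_.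
Qed.

Lemma in_span_sum V (s : seq V) (c : V -> R) : in_span s (\sum_(b <- s) c b *: b).
Proof.
elim: s => [|a s IH]; first by rewrite big_nil; apply/in_span_nil.
by rewrite big_cons; apply/in_span_cons; exists (c a); rewrite addrC addKr.
Qed.

Definition spanned V (B : V -> Prop) v : Prop :=
  exists2 s : seq V, (forall b, b \in s -> B b) & in_span s v.

Lemma spanned_submodp V (B : V -> Prop) : submodp (spanned B).
Proof.
split=> [|a u v [s sB us] [t tB vt]]; first by exists [::] => //; apply/in_span_nil.
exists (s ++ t) => [b|]; first by rewrite mem_cat => /orP [/sB|/tB].
apply/in_span_cat; exists (a *: u); last by rewrite addrC addKr.
by apply: submodpZ => //; apply: in_span_submodp.
Qed.

Lemma spanned_seq V (B : V -> Prop) (s : seq V) : (forall b, b \in s -> spanned B b) ->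
  exists t, [/\ uniq t, forall b, b \in t -> B b & forall b, b \in s -> in_span t b].
Proof.
elim: s => [|a s IH] sB; first by exists [::].
have [t [ut tB st]] := IH (fun b bs => sB b (mem_behead (s := a :: s) bs)).
have [t' t'B at'] := sB a (mem_head _ _).
exists (undup (t ++ t')); split=> [|b|b]; first exact: undup_uniq.
  by rewrite mem_undup mem_cat => /orP [/tB|/t'B].
rewrite inE => /orP [/eqP ->|/st].
  by apply: in_span_subset at' => y; rewrite mem_undup mem_cat orbC => ->.
by apply: in_span_subset => y; rewrite mem_undup mem_cat => ->.
Qed.

(* For a module killed by [I], freeness over [R/I] expressed over [R]. *)
Definition free_modulo I V : Prop := exists B : V -> Prop,
  (forall v, spanned B v) /\
  (forall (s : seq V) (c : V -> R), uniq s -> (forall b, b \in s -> B b) ->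
     \sum_(b <- s) c b *: b = 0 -> forall b, b \in s -> c b \in I).

Lemma pi_ideal0 I r : \pi_({ideal_quot I}) r = 0 <-> r \in I.
Proof.
rewrite -[r in r \in I]subr0 Quotient.idealrBE rmorph0.
by split=> [->|/eqP].
Qed.

Lemma pi_ideal_surj I (a : {ideal_quot I}) : exists r, \pi_({ideal_quot I}) r = a.
Proof. by exists (repr a); rewrite reprK. Qed.

Lemma free_moduleE I V (W : lmodType {ideal_quot I}) (phi : {additive W -> V}) :
    bijective phi -> (forall r w, phi (\pi_({ideal_quot I}) r *: w) = r *: phi w) ->
  free_module W <-> free_modulo I V.
Proof.
move=> [psi phiK psiK] phiZ.
have psiZ r v : psi (r *: v) = \pi_({ideal_quot I}) r *: psi v.
  by rewrite -[v in LHS]psiK -phiZ phiK.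
have psi_inj := can_inj psiK; have phi_inj := can_inj phiK.
split=> -[B [spanB indB]].
  exists (fun v => B (psi v)); split=> [v|s c us sB e b bs].
    have [s sB [c e]] := spanB (psi v).
    exists (map phi s) => [_ /mapP [w /sB Bw ->]|]; first by rewrite phiK.
    exists (fun i => repr (c i)); rewrite -[v]psiK e raddf_sum size_map.
    by apply: eq_bigr => i _; rewrite (nth_map 0) // -phiZ reprK.
  apply/pi_ideal0; rewrite -[b]psiK.
  apply: (indB (map psi s) (fun w => \pi_({ideal_quot I}) (c (phi w)))).
  - by rewrite map_inj_uniq.
  - by move=> _ /mapP [w /sB Bw ->].
  - apply: phi_inj; rewrite raddf_sum raddf0 big_map -[RHS]e.
    by apply: eq_bigr => x _; rewrite phiZ psiK.
  - exact: map_f.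
exists (fun w => B (phi w)); split=> [w|s c us sB e b bs].
  have [s sB [c e]] := spanB (phi w).
  exists (map psi s) => [_ /mapP [v /sB Bv ->]|]; first by rewrite psiK.
  exists (fun i => \pi_({ideal_quot I}) (c i)); apply: phi_inj.
  rewrite e raddf_sum size_map.
  by apply: eq_bigr => i _; rewrite (nth_map 0) // phiZ psiK.
rewrite -[c b]reprK; apply/pi_ideal0; rewrite -[b]phiK.
apply: (indB (map phi s) (fun v => repr (c (psi v)))).
- by rewrite map_inj_uniq.
- by move=> _ /mapP [w /sB Bw ->].
- rewrite -[RHS](raddf0 phi) -e raddf_sum big_map.
  by apply: eq_bigr => x _; rewrite -phiZ phiK reprK.
- exact: map_f.
Qed.

Lemma free_redE I V F (q : {linear V -> F}) :
    (forall y, exists v, q v = y) -> (forall v, q v = 0 <-> v \in idealmod V I) ->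
  free_module (red I V : lmodType {ideal_quot I}) <-> free_modulo I F.
Proof.
move=> qs q0; have [||g gP] := @factor_linear _ _ _ _ (quotmod_pi (idealmod V I)) q.
- exact: quotmod_pi_surj.
- by move=> v /quotmod_pi0/q0.
have red_surj (x : red I V) : exists v, quotmod_pi (idealmod V I) v = x.
  exact: quotmod_pi_surj.
have ga : zmod_morphism (g : red I V -> F) by move=> u v; exact: (linearB g).
pose phi : {additive red I V -> F} :=
  HB.pack_for {additive red I V -> F} (g : red I V -> F)
    (GRing.isZmodMorphism.Build (red I V) F (g : red I V -> F) ga).
apply: (@free_moduleE I F _ phi) => [|r w].
  have [psi psiP] := choice qs.
  exists (fun y => quotmod_pi (idealmod V I) (psi y)) => [w|y] /=; last by rewrite gP.
  have [v <-] := red_surj w; apply/quotmod_piE/q0.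
  by rewrite linearB psiP gP subrr.
have [v <-] := red_surj w.
transitivity (g (quotmod_pi (idealmod V I) (r *: v))); last by rewrite /= !gP linearZ.
by congr (g _); exact: red_scale_pi.
Qed.

(** A direct sum of copies of [X] indexed by [r]. In this equational form it is carried over by Hom
    in either variable ([biproduct_postcomp], [biproduct_precomp]). *)
Definition biproduct X Z (J : eqType) (r : seq J)
    (inj : J -> {linear X -> Z}) (proj : J -> {linear Z -> X}) : Prop :=
  (forall i j x, i \in r -> j \in r -> proj i (inj j x) = if i == j then x else 0) /\
  (forall z, z = \sum_(i <- r) inj i (proj i z)).

Lemma free_modulo_biproduct I X Z (J : eqType) (r : seq J)
    (inj : J -> {linear X -> Z}) (proj : J -> {linear Z -> X}) :
  biproduct r inj proj -> free_modulo I X -> free_modulo I Z.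
Proof.
move=> [projK sumE] [B [spanB indB]].
pose B' z := exists i, exists2 b, i \in r /\ B b & z = inj i b.
exists B'; split=> [z|s c us sB e z0 z0s].
  have hB' := spanned_submodp B'.
  rewrite (sumE z) big_seq; elim/big_rec: _ => [|i y ir yB]; first by case: hB'.
  apply: submodpD yB => //.
  have [s sB [c ->]] := spanB (proj i z).
  exists (map (inj i) s) => [_ /mapP [b /sB Bb ->]|]; first by exists i, b.
  exists c; rewrite linear_sum size_map.
  by apply: eq_bigr => k _; rewrite linearZ (nth_map 0).
have [i [b0 [ir Bb0] ez0]] := sB z0 z0s.
(* [p] selects the elements of [s] coming from the copy of [X] that contains [z0]; [proj i] kills
   the others in the relation. *)
pose p z := `[< B (proj i z) /\ inj i (proj i z) = z >].
have pz0 : p z0 by apply/asboolP; rewrite ez0 projK // eqxx.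
have -> : c z0 = c (inj i (proj i z0)) by case/asboolP: pz0 => _ ->.
apply: (indB (map (proj i) (filter p s)) (fun x => c (inj i x))).
- rewrite map_inj_in_uniq ?filter_uniq // => z z'.
  rewrite !mem_filter => /andP [/asboolP [_ <-] _] /andP [/asboolP [_ <-] _].
  by rewrite !projK // eqxx => ->.
- by move=> _ /mapP [z + ->]; rewrite mem_filter => /andP [/asboolP []].
- rewrite big_map big_filter -[RHS](linear0 (proj i)) -e linear_sum.
  rewrite big_mkcond; apply: eq_big_seq => z zs; rewrite linearZ /=.
  case: ifP => [/asboolP [_ ->] //|/negbT/asboolPn np].
  have [j [b [jr Bb] ez]] := sB z zs.
  rewrite [in RHS]ez projK //; case: eqP => [ij|_]; last by rewrite scaler0.
  by case: np; rewrite ez -ij projK // eqxx.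
- by apply: map_f; rewrite mem_filter pz0.
Qed.

Lemma free_modulo_iso I X Z (f : {linear X -> Z}) :
    (forall z, exists x, f x = z) -> (forall x, f x = 0 -> x = 0) ->
  free_modulo I X <-> free_modulo I Z.
Proof.
move=> fs f0; have [||g fK] := @factor_linear _ _ _ _ f (idfun : {linear X -> X}) => //.
have gK z : f (g z) = z by have [x <-] := fs z; rewrite fK.
split.
  apply: (@free_modulo_biproduct I X Z unit [:: tt] (fun=> f) (fun=> g)).
  by split=> [[] [] x _ _|z]; rewrite ?eqxx ?fK // big_seq1 gK.
apply: (@free_modulo_biproduct I Z X unit [:: tt] (fun=> g) (fun=> f)).
by split=> [[] [] x _ _|z]; rewrite ?eqxx ?gK // big_seq1 fK.
Qed.

(** * Direct summands of free modules over a local ring *)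

Section Local.
Variables (m I : idealr R).
Hypothesis hm : local_ring m.

(** In a generating list of least length, a relation with a coefficient outside [m], hence a unit,
    would make one generator redundant. *)
Lemma minimal_generators X : finite_module X ->
  exists e : seq X, [/\ uniq e, forall v, in_span e v &
    forall c : X -> R, \sum_(b <- e) c b *: b = 0 -> forall b, b \in e -> c b \in m].
Proof.
move=> [e0 e0P]; pose P k := `[< exists2 e : seq X, size e = k & forall v, in_span e v >].
have exP : exists k, P k by exists (size e0); apply/asboolP; exists e0.
have [k /asboolP [e sz gen] kmin] := ex_minnP exP.
have min (t : seq X) : (forall v, in_span t v) -> (size e <= size t)%N.
  by move=> tP; rewrite sz; apply: kmin; apply/asboolP; exists t.
have ue : uniq e.
  apply: contraT => nu; have : (size e <= size (undup e))%N.
    by apply: min => v; apply: in_span_subset (gen v) => b; rewrite mem_undup.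
  by rewrite leqNgt ltn_size_undup nu.
exists e; split=> // c e0' b be; apply: contraT => /(local_unit hm) [d dc].
have : (size e <= size (rem b e))%N.
  apply: min => v; apply: in_span_trans (gen v) => a ae.
  have [->|ab] := eqVneq a b; last by apply: in_span_mem; rewrite mem_rem_uniq // !inE ab.
  move: e0'; rewrite (perm_big _ (perm_to_rem be)) big_cons => /eqP.
  rewrite addr_eq0 => /eqP eb.
  have hb := in_span_submodp (rem b e).
  have := submodpZ d hb (submodpN hb (in_span_sum (rem b e) c)).
  by rewrite -eb scalerA dc scale1r.
by rewrite size_rem // leqNgt prednK ?leqnn //; case: (e) be.
Qed.

(** With [a] and [p] the matrices of [inj] and [proj], minimality of [e] puts the entries of
    [D = 1 - a p] in [m]. A relation [c] on [e] satisfies [c a = 0] modulo [I] by independence in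
    [Z], so [c = c D] modulo [I], and Nakayama's lemma puts [c] in [I]. *)
Lemma free_modulo_summand X Z (inj : {linear X -> Z}) (proj : {linear Z -> X}) :
  cancel inj proj -> finite_module X -> free_modulo I Z -> free_modulo I X.
Proof.
move=> injK finX [B [spanB indB]].
have [e [ue gen emin]] := minimal_generators finX.
exists (fun b => b \in e); split=> [v|s c us se rel]; first by exists e.
(* A relation on part of [e] extends by zero coefficients to all of [e]. *)
have key : forall c : X -> R,
    \sum_(b <- e) c b *: b = 0 -> forall b, b \in e -> c b \in I; last first.
  move=> b bs; have := key (fun b => if b \in s then c b else 0) _ b (se b bs).
  rewrite bs; apply; rewrite -[RHS]rel.
  transitivity (\sum_(b <- e | b \in s) c b *: b).
    by rewrite [RHS]big_mkcond; apply: eq_bigr => x _; case: ifP; rewrite ?scale0r.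
  rewrite -big_filter; apply: perm_big; apply: uniq_perm; rewrite ?filter_uniq //.
  by move=> x; rewrite mem_filter andb_idr // => /se.
move=> {s us se rel} {}c rel.
have [t [ut tB et]] : exists t, [/\ uniq t, forall b, b \in t -> B b &
    forall z, z \in map inj e -> in_span t z] by apply: spanned_seq.
have /choice [a aP] : forall x, exists a : Z -> R,
    x \in e -> inj x = \sum_(z <- t) a z *: z.
  move=> x; case: (boolP (x \in e)) => [xe|_]; last by exists (fun=> 0).
  by have [a ea] := in_span_uniq ut (et _ (map_f inj xe)); exists a.
have /choice [p pP] : forall z, exists p : X -> R, proj z = \sum_(y <- e) p y *: y.
  by move=> z; apply: in_span_uniq.
pose D x y := (x == y)%:R - \sum_(z <- t) a x z * p z y.
have Dm x : x \in e -> forall y, y \in e -> D x y \in m.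
  move=> xe; apply: emin; rewrite /D.
  under eq_bigr do rewrite scalerBl; rewrite sumrB.
  have -> : \sum_(y <- e) (x == y)%:R *: y = x.
    rewrite (bigD1_seq x) //= eqxx scale1r big1 ?addr0 // => y /negPf.
    by rewrite eq_sym => ->; rewrite scale0r.
  apply/eqP; rewrite subr_eq0; apply/eqP.
  rewrite -[LHS]injK aP // linear_sum.
  under eq_bigr do rewrite linearZ /= pP scaler_sumr.
  rewrite exchange_big; apply: eq_bigr => y _; rewrite scaler_suml.
  by apply: eq_bigr => z _; rewrite scalerA.
have cI z : z \in t -> \sum_(x <- e) c x * a x z \in I.
  apply: (indB t (fun z => \sum_(x <- e) c x * a x z)) => //.
  rewrite -[RHS](linear0 inj) -rel linear_sum.
  under eq_bigr do rewrite scaler_suml.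
  rewrite exchange_big; apply: eq_big_seq => x xe.
  by rewrite linearZ /= aP // scaler_sumr; apply: eq_bigr => w _; rewrite scalerA.
have hI : submodp (V := R^o) (fun r => r \in I).
  by split=> [|r u v uI vI]; rewrite ?rpred0 // rpredD // idealMr.
move=> b be.
have nak := @nakayama R m hm R^o _ (map c e) hI.
apply: nak (map_f c be) => _ /mapP [y ye ->].
(* The default 0 outside [e] is there because [in_mspan_sum] asks for coefficients in [m] at every
   index. *)
apply: (in_mspan_sum (c := fun x => if x \in e then D x y else 0)).
  by move=> x; case: ifP => [xe|_]; rewrite ?rpred0 // Dm.
have -> : c y = \sum_(x <- e) c x * (x == y)%:R.
  rewrite (bigD1_seq y) //= eqxx mulr1 big1 ?addr0 // => x /negPf ->.
  by rewrite mulr0.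
rewrite -sumrB big_seq.
under eq_bigr => x xe.
  rewrite xe [_ *: _]mulrC -mulrBr /D opprB addrC subrK mulr_sumr.
  under eq_bigr do rewrite mulrA.
  over.
rewrite -big_seq exchange_big big_seq; apply: rpred_sum => z zt.
by rewrite -mulr_suml mulrC idealMr // cI.
Qed.

Lemma free_modulo_biproductE X Z (J : eqType) (r : seq J)
    (inj : J -> {linear X -> Z}) (proj : J -> {linear Z -> X}) :
    biproduct r inj proj -> (0 < size r)%N -> finite_module Z ->
  free_modulo I X <-> free_modulo I Z.
Proof.
move=> bp r0 finZ; split; first exact: free_modulo_biproduct bp.
have [i ir] : exists i, i \in r by case: (r) r0 => // i r' _; exists i; rewrite mem_head.
have iK : cancel (inj i) (proj i) by move=> x; rewrite bp.1 // eqxx.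
apply: (free_modulo_summand iK).
apply: (finite_surj (f := proj i)) finZ => x.
by exists (inj i x); apply: iK.
Qed.

End Local.

(** * Finite free modules as powers of [R/I], and Hom of such powers *)

Definition quotR I : lmodType R :=
  restrict (\pi_({ideal_quot I}) : {rmorphism R -> {ideal_quot I}}) {ideal_quot I}^o.

Lemma quotR_scale I (r : R) (a : {ideal_quot I}) :
  r *: (a : quotR I) = \pi_({ideal_quot I}) r * a.
Proof. by []. Qed.

(** Finitely many basis elements generate [F]. Sending the class of [r] to [r *: b] makes sense
    because [I] kills [F], and coordinates are unique modulo [I]. *)
Lemma free_modulo_quotR I F :
    finite_module F -> (forall c (v : F), c \in I -> c *: v = 0) -> free_modulo I F ->
  exists (e : seq F) (inj : F -> {linear quotR I -> F})
    (proj : F -> {linear F -> quotR I}), biproduct e inj proj.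
Proof.
move=> [g gP] IF [B [spanB indB]].
have [e [ue eB ge]] := spanned_seq (fun b (_ : b \in g) => spanB b).
have gen v : in_span e v by apply: in_span_trans (gP v).
have coord v := in_span_uniq ue (gen v).
have /choice [inj injP] : forall b, exists f : {linear quotR I -> F},
    forall r, f (\pi_({ideal_quot I}) r) = r *: b.
  move=> b; have [x|c u u' v v' [r <- <-] [r' <- <-]|v [r /pi_ideal0 rI <-]|f fP] :=
    @linear_choice R (quotR I) F (fun x v => exists2 r, \pi_({ideal_quot I}) r = x & r *: b = v).
  - by have [r <-] := pi_ideal_surj x; exists (r *: b), r.
  - by exists (c * r + r'); rewrite ?rmorphD ?rmorphM // scalerDl scalerA.
  - exact: IF.
  exists f => r; have [r' rr' <-] := fP (\pi_({ideal_quot I}) r).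
  apply/eqP; rewrite -subr_eq0 -scalerBl; apply/eqP/IF/pi_ideal0.
  by rewrite rmorphB /= rr' subrr.
have /choice [proj projP] : forall b, exists f : {linear F -> quotR I}, b \in e ->
    forall c : F -> R, f (\sum_(y <- e) c y *: y) = \pi_({ideal_quot I}) (c b).
  move=> b; have [be|_] := boolP (b \in e); last by exists (\0).
  have [v|r u u' v v' [c -> ->] [c' -> ->]|v [c /esym c0 ->]|f fP] :=
    @linear_choice R F (quotR I) (fun v x => exists2 c : F -> R,
      v = \sum_(y <- e) c y *: y & x = \pi_({ideal_quot I}) (c b)).
  - by have [c ->] := coord v; exists (\pi_({ideal_quot I}) (c b)), c.
  - exists (fun y => r * c y + c' y); last by rewrite rmorphD rmorphM.
    rewrite scaler_sumr -big_split; apply: eq_bigr => y _.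
    by rewrite scalerDl scalerA.
  - by apply/pi_ideal0; apply: indB c0 _ be.
  exists f => _ c; have [c' ec ->] := fP (\sum_(y <- e) c y *: y).
  apply/eqP; rewrite -subr_eq0 -rmorphB; apply/eqP/pi_ideal0.
  apply: (indB e (fun y => c' y - c y)) => //.
  under eq_bigr do rewrite scalerBl.
  by rewrite sumrB -ec subrr.
exists e, inj, proj; split=> [i j x ie je|v].
  have [r <-] := pi_ideal_surj x; rewrite injP.
  have -> : r *: j = \sum_(y <- e) (if y == j then r else 0) *: y.
    rewrite (bigD1_seq j) //= eqxx big1 ?addr0 // => y /negPf ->.
    by rewrite scale0r.
  by rewrite projP //; case: eqP => // _; rewrite rmorph0.
have [c ->] := coord v; apply: eq_big_seq => b be.
by rewrite projP // injP.
Qed.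

Definition postcomp (M F W : lmodType R) (f : {linear F -> W}) (g : lhom M F) : lhom M W :=
  (f \o g : {linear M -> W}).

Lemma postcomp_linear (M F W : lmodType R) (f : {linear F -> W}) : linear (@postcomp M F W f).
Proof. by move=> a g h; apply: lhomP => u; rewrite /= linearP. Qed.

HB.instance Definition _ (M F W : lmodType R) (f : {linear F -> W}) :=
  GRing.isLinear.Build R (lhom M F) (lhom M W) *:%R (@postcomp M F W f)
    (postcomp_linear f).

Lemma biproduct_postcomp (M : lmodType R) X Z (J : eqType) (r : seq J)
    (inj : J -> {linear X -> Z}) (proj : J -> {linear Z -> X}) :
  biproduct r inj proj ->
  biproduct r (fun i => postcomp (inj i) : {linear lhom M X -> lhom M Z})
    (fun i => postcomp (proj i) : {linear lhom M Z -> lhom M X}).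
Proof.
move=> [projK sumE]; split=> [i j f ir jr|f].
  by apply: lhomP => u; rewrite /= projK //; case: eqP.
by apply: lhomP => u; rewrite lhom_sumE [LHS]sumE.
Qed.

Lemma biproduct_precomp (N : lmodType R) X Z (J : eqType) (r : seq J)
    (inj : J -> {linear X -> Z}) (proj : J -> {linear Z -> X}) :
  biproduct r inj proj ->
  biproduct r (fun i => precomp (proj i) : {linear lhom X N -> lhom Z N})
    (fun i => precomp (inj i) : {linear lhom Z N -> lhom X N}).
Proof.
move=> [projK sumE]; split=> [i j f ir jr|f].
  apply: lhomP => u; rewrite /= projK // eq_sym.
  by case: eqP => // _; rewrite linear0.
by apply: lhomP => u; rewrite lhom_sumE [in LHS](sumE u) linear_sum.
Qed.

End FreeModulo.

(** * The residual homomorphism modules *)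

Section HomToRestrict.
Variables (R A B : comNzRingType) (f : {rmorphism A -> B}).
Variables (p : {rmorphism R -> A}) (q : {rmorphism R -> B}).
Hypotheses (fp : forall r, f (p r) = q r) (ps : forall a, exists r, p r = a).
Variables (Y : lmodType R) (X : lmodType A) (W : lmodType B) (c : {additive Y -> X}).
Hypotheses (cs : forall x, exists y, c y = x).
Hypothesis (cZ : forall r y, c (r *: y) = p r *: c y).
Hypothesis (c0 : forall (h : lhom Y (restrict q W)) y, c y = 0 -> h y = 0).

(** As [p] is surjective, [A]-linearity amounts to [R]-linearity, and [c0] makes every map on [Y]
    factor through [X]. The conclusion has the shape that [free_moduleE] takes. *)
Lemma hom_to_restrict :
  exists2 phi : {additive hom_to f X W -> lhom Y (restrict q W)},
    bijective phi & forall r g, phi (q r *: g) = r *: phi g.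
Proof.
have fromL (g : hom_to f X W) :
    linear (fun y => (g : lhom X (restrict f W)) (c y) : restrict q W).
  move=> r u v; rewrite raddfD cZ.
  have e := linearP (g : lhom X (restrict f W)) (p r) (c u) (c v).
  apply: (etrans e); rewrite [LHS]/(f (p r) *: _ + _ : W) fp.
  by [].
pose from (g : hom_to f X W) : lhom Y (restrict q W) :=
  HB.pack_for {linear Y -> restrict q W}
    (fun y => (g : lhom X (restrict f W)) (c y) : restrict q W)
    (GRing.isLinear.Build R Y (restrict q W) *:%R _ (fromL g)).
have /choice [d dK] := cs.
have dh (h : lhom Y (restrict q W)) y : h (d (c y)) = h y.
  by apply/eqP; rewrite -subr_eq0 -linearB c0 // raddfB dK subrr.
have toL (h : lhom Y (restrict q W)) : linear (fun x => h (d x) : restrict f W).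
  move=> a x x'; have [[[r <-] [y <-]] [y' <-]] := (ps a, cs x, cs x').
  rewrite -cZ -raddfD !dh; apply: (etrans (linearP h r y y')).
  by rewrite [LHS]/(q r *: _ + _ : W) -fp.
pose to (h : lhom Y (restrict q W)) : hom_to f X W :=
  HB.pack_for {linear X -> restrict f W} (fun x => h (d x) : restrict f W)
    (GRing.isLinear.Build A X (restrict f W) *:%R _ (toL h)).
have fromD : zmod_morphism from by move=> g h; apply: lhomP => y.
pose phi : {additive hom_to f X W -> lhom Y (restrict q W)} :=
  HB.pack_for {additive hom_to f X W -> lhom Y (restrict q W)} from
    (GRing.isZmodMorphism.Build (hom_to f X W) (lhom Y (restrict q W)) from fromD).
exists phi => [|r g]; last by apply: lhomP.
exists to => [g|h]; apply: lhomP => y; last exact: dh.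
by rewrite [LHS]/((g : lhom X (restrict f W)) (c (d y))) dK.
Qed.

End HomToRestrict.

Section HomFromRestrict.
Variables (R A B : comNzRingType) (f : {rmorphism A -> B}).
Variables (p : {rmorphism R -> A}) (q : {rmorphism R -> B}).
Hypotheses (fp : forall r, f (p r) = q r) (ps : forall a, exists r, p r = a).
Variables (W : lmodType B) (X : lmodType A) (Y : lmodType R) (c : {additive X -> Y}).
Hypotheses (c_bij : bijective c) (cZ : forall r x, c (p r *: x) = r *: c x).

Lemma hom_from_restrict :
  exists2 phi : {additive hom_from f W X -> lhom (restrict q W) Y},
    bijective phi & forall r g, phi (q r *: g) = r *: phi g.
Proof.
have fromL (g : hom_from f W X) :
    linear (fun w : restrict q W => c ((g : lhom (restrict f W) X) w)).
  move=> r v w; rewrite -cZ -raddfD; congr (c _).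
  rewrite -(linearP (g : lhom (restrict f W) X)); congr ((g : lhom _ _) _).
  by rewrite [RHS]/(f (p r) *: (v : W) + w) fp.
pose from (g : hom_from f W X) : lhom (restrict q W) Y :=
  HB.pack_for {linear restrict q W -> Y}
    (fun w : restrict q W => c ((g : lhom (restrict f W) X) w))
    (GRing.isLinear.Build R (restrict q W) Y *:%R _ (fromL g)).
have [d cK dK] := c_bij; have c_inj := can_inj cK.
have toL (h : lhom (restrict q W) Y) : linear (fun w : restrict f W => d (h w)).
  move=> a v w; have [r <-] := ps a; apply: c_inj.
  rewrite [RHS]raddfD cZ !dK; apply: (etrans _ (linearP h r v w)); congr (h _).
  by rewrite [LHS]/(f (p r) *: (v : W) + w) fp.
pose to (h : lhom (restrict q W) Y) : hom_from f W X :=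
  HB.pack_for {linear restrict f W -> X} (fun w : restrict f W => d (h w))
    (GRing.isLinear.Build A (restrict f W) X *:%R _ (toL h)).
have fromD : zmod_morphism from.
  by move=> g h; apply: lhomP => w; rewrite /= raddfB.
pose phi : {additive hom_from f W X -> lhom (restrict q W) Y} :=
  HB.pack_for {additive hom_from f W X -> lhom (restrict q W) Y} from
    (GRing.isZmodMorphism.Build (hom_from f W X) (lhom (restrict q W) Y) from fromD).
exists phi => [|r g]; last first.
  by apply: lhomP => w; rewrite -[RHS]/(r *: from g w) -linearZ.
by exists to => [g|h]; apply: lhomP => w; rewrite /= ?cK ?dK.
Qed.

End HomFromRestrict.

Section HomBridges.
Variables (R : comNzRingType) (I Q : idealr R) (QI : {subset Q <= I}).
Implicit Types M N : lmodType R.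

Lemma red_scaleE N r (w : red Q N) :
  \pi_({ideal_quot Q}) r *: w = r *: (w : quotmod (idealmod N Q)) :> quotmod (idealmod N Q).
Proof.
have [v <-] : exists v, quotmod_pi (idealmod N Q) v = w by exact: quotmod_pi_surj.
exact: etrans (red_scale_pi Q r v) (esym (quotmod_scale_pi _ r v)).
Qed.

Lemma free_hom_fromE N :
  free_module (hom_from (quot_map QI) {ideal_quot I}^o (red Q N) : lmodType {ideal_quot I})
  <-> free_modulo I (lhom (quotR I) (quotmod (idealmod N Q))).
Proof.
pose W : lmodType R := quotmod (idealmod N Q).
have cD : zmod_morphism (id : red Q N -> W) by [].
pose c : {additive red Q N -> W} := HB.pack_for {additive red Q N -> W}
  (id : red Q N -> W) (GRing.isZmodMorphism.Build (red Q N) W _ cD).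
have [||||phi phi_bij phiZ] := @hom_from_restrict R {ideal_quot Q} {ideal_quot I}
  (quot_map QI) (\pi_({ideal_quot Q})) (\pi_({ideal_quot I}))
  _ _ {ideal_quot I}^o (red Q N) W c.
- by move=> r; exact: quot_map_pi.
- exact: pi_ideal_surj.
- by exists id.
- exact: red_scaleE.
exact: (free_moduleE phi_bij phiZ).
Qed.

(** Since [Q] lies in [I], every map from [M] to [R/I] kills [QM], so [M/QM] may be replaced by
    [M]. *)
Lemma free_hom_toE M :
  free_module (hom_to (quot_map QI) (red Q M) {ideal_quot I}^o : lmodType {ideal_quot I})
  <-> free_modulo I (lhom M (quotR I)).
Proof.
pose W : lmodType R := quotmod (idealmod M Q).
have cD : zmod_morphism (quotmod_pi (idealmod M Q) : M -> red Q M).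
  by move=> u v; exact: (linearB (quotmod_pi (idealmod M Q))).
pose c : {additive M -> red Q M} := HB.pack_for {additive M -> red Q M}
  (quotmod_pi (idealmod M Q) : M -> red Q M)
  (GRing.isZmodMorphism.Build M (red Q M) _ cD).
have [||||h y|phi phi_bij phiZ] := @hom_to_restrict R {ideal_quot Q} {ideal_quot I}
  (quot_map QI) (\pi_({ideal_quot Q})) (\pi_({ideal_quot I}))
  _ _ M (red Q M) {ideal_quot I}^o c.
- by move=> r; exact: quot_map_pi.
- exact: pi_ideal_surj.
- exact: quotmod_pi_surj.
- by move=> r y; exact/esym/red_scale_pi.
- move=> /quotmod_pi0/asboolP [s [sQ ->]]; rewrite linear_sum big1_seq // => -[a v] /= av.
  have /andP [/QI/pi_ideal0 a0 _] := allP sQ _ av.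
  by rewrite linearZ /= quotR_scale a0 mul0r.
exact: (free_moduleE phi_bij phiZ).
Qed.

End HomBridges.

(** * Parameter ideals and Ulrich modules *)

Section ParameterIdeals.
Variables (R : comNzRingType) (m Q : idealr R) (x : seq R).
Hypotheses (noethR : noetherian R) (hm : local_ring m).
Hypotheses (Qx : forall a, a \in Q <-> in_span (x : seq R^o) a) (mQ : primary_to m Q).
Implicit Types V M N : lmodType R.

Lemma idealmod_in_seqmod V (v : V) : v \in idealmod V Q <-> in_seqmod x v.
Proof.
have hx := in_seqmod_submodp V x.
split=> [/asboolP [s [sQ ->]]|].
  rewrite big_seq; elim/big_rec: _ => [|[a u] w /= au xw]; first by case: hx.
  apply: submodpD xw => //.
  by have /andP [/Qx/in_seqmod_span ax _] := allP sQ _ au.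
apply: (in_seqmod_sub (S := fun v => v \in idealmod V Q)) => [|a u ax].
  by split=> [|a u w uI wI]; rewrite ?rpred0 // rpredD // rpredZ.
apply/asboolP; exists [:: (a, u)]; rewrite big_seq1 /= !andbT.
by split=> //; apply/Qx/in_span_mem.
Qed.

Lemma primary_sub : {subset Q <= m}.
Proof. by move=> a aQ; apply/mQ.2; exists 1%N. Qed.

Lemma parameters_sub : all [in m] x.
Proof. by apply/allP => a ax; apply/primary_sub/Qx/in_span_mem. Qed.

(** Every element of [m] has a power in [Q], as the Koszul argument asks of the entries of [s]. The
    list [t] allows both [x] and its reverse. *)
Lemma koszul_exact_depth V (t s : seq R) :
  x =i t -> all [in m] s -> weakly_regular V s -> koszul_exact V t (size s).
Proof.
move=> xt sm regs; apply: weakly_regular_koszul_exact regs _ => a /(allP sm)/mQ.2.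
case=> n /Qx h; exists n; apply: in_span_subset h => b.
by rewrite xt.
Qed.

Lemma maximal_CM_weakly_regular V :
  krull_dim R (size x) -> maximal_CM m V -> weakly_regular V x.
Proof.
move=> [[p pch] dimx] [finV [d [[p' p'ch] dimd] [[s [sm [regs _] ds]] _]]].
have {}ds : size s = size x.
  by apply/eqP; rewrite ds eqn_leq (dimx _ _ p'ch) (dimd _ _ pch).
(* The Koszul criterion returns the reversed list, so it is applied to [rev x]. *)
rewrite -[x]revK; apply: (koszul_exact_weakly_regular hm).
- exact: finite_noetherian.
- by rewrite all_rev parameters_sub.
- rewrite size_rev -ds; apply: koszul_exact_depth => //.
  by move=> a; rewrite mem_rev.
Qed.

(** A longer sequence would give exactness in every degree up to the top, so [V = xV] and [V = 0] by
    Nakayama's lemma, against the second clause of [regular_seq]. *)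
Lemma regular_seq_size V (s : seq R) :
  finite_module V -> all [in m] s -> regular_seq V s -> (size s <= size x)%N.
Proof.
move=> finV sm [regs [v vs]]; rewrite leqNgt; apply/negP => lt_xs; apply: vs.
rewrite (nakayama_seqmod hm v finV parameters_sub) => [|u].
  by case: (in_seqmod_submodp V s).
apply: koszul_exact_top => i lt_i; apply: (koszul_exact_depth (s := s)) => //.
exact: leq_trans lt_i lt_xs.
Qed.

Lemma in_seqmod_linear V M (f : {linear V -> M}) (s : seq R) v :
  in_seqmod s v -> in_seqmod s (f v).
Proof.
move=> [w ->]; exists (fun j => f (w j)).
by rewrite linear_sum; apply: eq_bigr => j _; rewrite linearZ.
Qed.

Lemma weakly_regular_take V (s : seq R) i :
  weakly_regular V s -> weakly_regular V (take i s).
Proof.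
move=> regs j v; rewrite size_take_min leq_min => /andP [ji js].
by rewrite nth_take // take_takel 1?ltnW //; apply: regs.
Qed.

(** * The module Hom(M, N) and its reduction modulo Q *)

Section UlrichHom.
Variables (I : idealr R) (M N : lmodType R).
Hypotheses (QI : {subset Q <= I}) (dimR : krull_dim R (size x)).
Hypotheses (mcmM : maximal_CM m M) (mcmN : maximal_CM m N).
Hypothesis (f0 : exists f : lhom M N, f != 0).
Hypothesis ext0 : ext_vanish M N (size x).-1.

Let regN := maximal_CM_weakly_regular dimR mcmN.

Lemma hom_in_idealmod (f : lhom M N) :
  f \in idealmod (lhom M N) Q <-> forall u, f u \in idealmod N Q.
Proof.
rewrite idealmod_in_seqmod; split=> [fQ u|fQ].
  by apply/idealmod_in_seqmod; exact: (in_seqmod_linear (@hom_eval R M N u)).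
by apply: hom_in_seqmod => // u; apply/idealmod_in_seqmod.
Qed.

Lemma finite_hom : finite_module (lhom M N).
Proof.
apply/noetherian_module_finite/noetherian_lhom; first by case: mcmM.
by apply: finite_noetherian => //; case: mcmN.
Qed.

(** By [hom_in_seqmod], membership in the submodules generated by initial segments of [x] is decided
    on values, so regularity is inherited from [N]. A nonzero map and Nakayama's lemma give the
    second clause of [regular_seq]. *)
Lemma maximal_CM_hom : maximal_CM m (lhom M N).
Proof.
split; first exact: finite_hom.
exists (size x) => //; split; last exact: (fun s => regular_seq_size finite_hom).
exists x; split=> //; first exact: parameters_sub.
split=> [i f lt_ix xf|].
  apply: hom_in_seqmod => [||u]; first exact: weakly_regular_take.
    move=> j lt_j; apply: ext0; apply: (leq_trans lt_j).
    by rewrite (size_takel (ltnW lt_ix)) -!subn1 leq_sub2r // ltnW.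
  apply: regN => //.
  exact: (in_seqmod_linear (@hom_eval R M N u) xf).
have [f fn0] := f0; apply: contrapT => nex; move/eqP: fn0; apply.
apply: (nakayama_seqmod hm f finite_hom parameters_sub) => g.
by apply: contrapT => ng; apply: nex; exists g.
Qed.

Hypothesis killed : forall c (f : lhom M N) u,
  c \in I -> c *: f u \in idealmod N Q.

(** By [killed], an element of [I] times a map has values in [QN], hence lies in [Q] times Hom(M,
    N). That hypothesis holds when [I] kills [M/QM] or [N/QN], which covers both versions of the
    theorem. *)
Lemma idealmod_hom : idealmod (lhom M N) I =i idealmod (lhom M N) Q.
Proof.
move=> f; apply/idP/idP => /asboolP [s [sI ->]].
  rewrite big_seq; apply: rpred_sum => -[c g] /= cg.
  have /andP [cI _] := allP sI _ cg.
  by apply/hom_in_idealmod => u; apply: killed.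
apply/asboolP; exists s; split=> //; apply: sub_all sI => p /andP [/QI pI pV].
exact/andP.
Qed.

Lemma ulrich_homE :
  ulrich m I Q (lhom M N) <-> free_module (red I (lhom M N) : lmodType {ideal_quot I}).
Proof.
split=> [[]//|fr]; split=> //; [exact: maximal_CM_hom|exact: idealmod_hom].
Qed.

(** Postcomposition with the projection of [N] is onto by [hom_lift_seqmod], where vanishing in
    degree [size x] enters; [idealmod_hom] identifies its kernel. *)
Lemma free_red_homE : ext_vanish M N (size x) ->
  free_module (red I (lhom M N) : lmodType {ideal_quot I}) <->
  free_modulo I (lhom M (quotmod (idealmod N Q))).
Proof.
move=> ext; pose p : {linear N -> quotmod (idealmod N Q)} := quotmod_pi (idealmod N Q).
apply: (free_redE (q := postcomp p : {linear lhom M N -> _})) => [h|f].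
  have [|v|g gP] := hom_lift_seqmod (q := p) h regN ext.
  - exact: quotmod_pi_surj.
  - by rewrite quotmod_pi0 idealmod_in_seqmod.
  by exists g; apply: lhomP.
rewrite idealmod_hom hom_in_idealmod; split=> [pf u|pf].
  by apply/quotmod_pi0; exact: (congr1 (fun g : lhom _ _ => g u) pf).
by apply: lhomP => u; apply/quotmod_pi0.
Qed.

End UlrichHom.

(** Since [IV = QV], the quotient [V/QV] is finite free over [R/I]; by Nakayama's lemma its rank is
    positive, which later lets freeness descend to a summand. *)
Lemma ulrich_biproduct (I : idealr R) V :
    {subset Q <= I} -> ulrich m I Q V -> (exists v : V, v != 0) ->
  exists (r : seq (quotmod (idealmod V Q)))
    (inj : _ -> {linear quotR I -> quotmod (idealmod V Q)})
    (proj : _ -> {linear quotmod (idealmod V Q) -> quotR I}),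
  (0 < size r)%N /\ biproduct r inj proj.
Proof.
move=> QI [[finV _] IQ frV] [v vn0].
pose p : {linear V -> quotmod (idealmod V Q)} := quotmod_pi (idealmod V Q).
have ps : forall y, exists u, p u = y by exact: quotmod_pi_surj.
have finF := finite_surj ps finV.
have frF : free_modulo I (quotmod (idealmod V Q)).
  have p0 u : p u = 0 <-> u \in idealmod V I by rewrite quotmod_pi0 IQ.
  exact: (free_redE ps p0).1 frV.
have [c y cI|r [inj [proj bp]]] := free_modulo_quotR finF _ frF.
  have [u <-] := ps y; rewrite -linearZ; apply/quotmod_pi0; rewrite -IQ.
  by apply/asboolP; exists [:: (c, u)]; rewrite big_seq1 /= cI.
exists r, inj, proj; split=> //; rewrite lt0n; apply/eqP => /size0nil r0.
move/eqP: vn0; apply; apply: (nakayama_seqmod hm v finV parameters_sub) => u.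
by apply/idealmod_in_seqmod/quotmod_pi0; rewrite [LHS]bp.2 r0 big_nil.
Qed.

End ParameterIdeals.

Theorem theorem3p2 (R : comNzRingType) (m I Q : idealr R) (d n : nat)
    (x : d.-tuple R) (M N : lmodType R) (hQI : {subset Q <= I}) :
  noetherian R -> local_ring m -> krull_dim R d -> cohen_macaulay_ring m ->
  primary_to m I -> parameter_ideal m x Q -> reduction Q I ->
  maximal_CM m M -> maximal_CM m N ->
  (exists f : lhom M N, f != 0) ->
  n = d.-1 \/ n = d ->
  (forall i, (1 <= i <= n)%N -> forall e : Ext M N i, e = 0) ->
  let cond_i := ulrich m I Q (lhom M N) in
  let cond_ii := free_module (red I (lhom M N) : lmodType {ideal_quot I}) in
  let conclusion (cond_iii : Prop) :=
    (n = d.-1 -> (cond_i <-> cond_ii)) /\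
    (n = d -> (cond_i <-> cond_ii) /\ (cond_ii <-> cond_iii)) in
  (ulrich m I Q M ->
   conclusion (free_module
     (hom_from (quot_map hQI) {ideal_quot I}^o (red Q N)
        : lmodType {ideal_quot I})))
  /\
  (ulrich m I Q N ->
   conclusion (free_module
     (hom_to (quot_map hQI) (red Q M) {ideal_quot I}^o
        : lmodType {ideal_quot I}))).
Proof.
move=> noethR hm dimR _ _ [dimx Qx mQ] _ mcmM mcmN f0 nd ext0 cond_i cond_ii conclusion.
have ext : ext_vanish M N n by exact: ext_vanish_Ext.
have ext1 : ext_vanish M N (size x).-1.
  move=> i lt_i; apply: ext; apply: (leq_trans lt_i); rewrite size_tuple.
  by case: nd => ->; rewrite ?leq_pred.
(* Both versions reduce to two points: why [I] sends values of homomorphisms into [QN], and how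
   (iii) compares with freeness of Hom(M, N/QN). *)
have equiv (P : Prop) : (forall c (f : lhom M N) u, c \in I -> c *: f u \in idealmod N Q) ->
    (n = d -> free_modulo I (lhom M (quotmod (idealmod N Q))) <-> P) -> conclusion P.
  move=> killed hP.
  have i_ii : cond_i <-> cond_ii by exact: (ulrich_homE noethR hm Qx mQ).
  split=> // nE; split=> //; rewrite -hP //.
  have extx : ext_vanish M N (size x) by rewrite size_tuple -nE.
  exact: (free_red_homE noethR hm Qx mQ).
have finW : finite_module (quotmod (idealmod N Q)).
  case: mcmN => finN _; apply: (finite_surj (f := quotmod_pi (idealmod N Q))) finN.
  exact: quotmod_pi_surj.
have finlhom F : finite_module F -> finite_module (lhom F (quotmod (idealmod N Q))).
  move=> finF; apply: noetherian_module_finite; apply: noetherian_lhom => //.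
  exact: finite_noetherian.
have [f fn0] := f0.
split=> [UM|UN]; apply: equiv => [c g u cI|nE].
(* Here [IM = QM], and [g] maps [QM] into [QN]. *)
- have {}cI : c *: u \in idealmod M Q.
    case: UM => _ <- _; apply/asboolP; exists [:: (c, u)].
    by rewrite big_seq1 /= cI.
  rewrite -linearZ; apply/(idealmod_in_seqmod Qx)/in_seqmod_linear.
  exact/(idealmod_in_seqmod Qx).
- pose p : {linear M -> quotmod (idealmod M Q)} := quotmod_pi (idealmod M Q).
  have ps y : exists u, p u = y by exact: quotmod_pi_surj.
  have Mn0 : exists u : M, u != 0.
    apply: contrapT => M0; move/eqP: fn0; apply; apply: lhomP => u.
    have -> : u = 0 by apply: contrapT => /eqP u0; apply: M0; exists u.
    by rewrite linear0.
  have [r [inj [proj [r0 bp]]]] := ulrich_biproduct hm Qx mQ hQI UM Mn0.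
  rewrite free_hom_fromE.
  (* Hom(M/QM, N/QN) is a direct sum of [size r] copies of Hom(R/I, N/QN). *)
  rewrite (free_modulo_biproductE I hm (biproduct_precomp _ bp) r0); last first.
    by apply: finlhom; case: mcmM => finM _; exact: finite_surj ps finM.
  (* [Q] kills [N/QN], so maps from [M] to it factor uniquely through [M/QM]. *)
  apply: iff_sym; apply: (@free_modulo_iso R I _ _ (precomp p)) => [h|h hp0].
    have [||g gP] := @factor_linear _ _ _ _ p h => //.
      move=> u /quotmod_pi0/asboolP [s [sQ ->]].
      rewrite linear_sum big1_seq // => -[c v] /= cs.
      have /andP [cQ _] := allP sQ _ cs.
      rewrite linearZ /=; have [w <-] := quotmod_pi_surj (h v).
      rewrite -linearZ; apply/quotmod_pi0/asboolP; exists [:: (c, w)].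
      by rewrite big_seq1 /= cQ.
    by exists g; apply: lhomP.
  apply: lhomP => y; have [u <-] := ps y.
  exact: (congr1 (fun g : lhom _ _ => g u) hp0).
- case: UN => _ <- _; apply/asboolP; exists [:: (c, g u)].
  by rewrite big_seq1 /= cI.
have Nn0 : exists u : N, u != 0.
  apply: contrapT => N0; move/eqP: fn0; apply; apply: lhomP => u.
  by apply: contrapT => /eqP fu; apply: N0; exists (f u).
have [r [inj [proj [r0 bp]]]] := ulrich_biproduct hm Qx mQ hQI UN Nn0.
rewrite free_hom_toE; apply: iff_sym.
apply: (free_modulo_biproductE I hm (biproduct_postcomp _ bp) r0).
by apply: finlhom; case: mcmM.
Qed.
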